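(* Let $\mathsf P$ be a principle having an $\omega$-model all of whose members are low${}_2$ sets, and such that $\mathsf{STS}(2) \leq_c \mathsf P$ or $\mathsf{SADS} \leq_c \mathsf P$. Then $\mathsf P$ admits no universal instance.
   Context: A principle $\mathsf{P}$ is a statement $\forall X(\Phi(X) \to \exists Y \Psi(X,Y))$ ($\Phi,\Psi$ arithmetical) with instances $X$ and solutions $Y$. A degree bounds $\mathsf P$ if every computable instance has a solution computable in it; $\mathsf P$ admits a universal instance if some computable instance has all its solutions bounding $\mathsf P$. $\mathsf{P} \leq_c \mathsf{Q}$ if every instance $X$ of $\mathsf P$ computes an instance $Y$ of $\mathsf Q$ such that every solution to $Y$ computes, together with $X$, a solution to $X$. An $\omega$-model of $\mathsf P$ is a nonempty collection of sets closed under $\oplus$ and $\leq_T$ in which every instance of $\mathsf P$ has a solution. $X$ is low${}_2$ if $X''\leq_T\emptyset''$. $\mathsf{STS}(2)$: every stable $g:[\omega]^2\to\omega$ (i.e. $\lim_s g(x,s)$ exists for all $x$) has an infinite set $A$ with $g([A]^2)\neq \omega$. $\mathsf{SADS}$: every linear order on $\omega$ in which every element has finitely many predecessors or finitely many successors has an infinite ascending or descending sequence. *)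

(* Defs.v *)
From Stdlib Require Import Arith.

Definition set := nat -> Prop.

Definition empty_set : set := fun _ => False.

Definition join (X Y : set) : set :=
  fun n => if Nat.even n then X (Nat.div2 n) else Y (Nat.div2 n).

Definition infinite (X : set) : Prop := forall n, exists m, n <= m /\ X m.

Definition npair (x y : nat) : nat := (x + y) * (x + y + 1) / 2 + y.

(** * Oracle computation
   Programs are natural numbers, denoting partial unary functions nat -> nat
   relative to an oracle A.  With c = 10 * k + t:
     t = 0 : zero           x |-> 0
     t = 1 : successor      x |-> x+1
     t = 2 : identity       x |-> x
     t = 3 : left proj.     <a,b> |-> a
     t = 4 : right proj.    <a,b> |-> b
     t = 5 : oracle         x |-> 1 if x \in A, 0 otherwise
     t = 6 : composition    k = <f,g> : x |-> f (g x)
     t = 7 : pairing        k = <f,g> : x |-> <f x, g x>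
     t = 8 : prim. rec.     k = <f,g> : h(<0,x>) = f x,
                               h(<n+1,x>) = g <<n, h(<n,x>)>, x>
     t = 9 : minimisation   k = f : x |-> least n with f <n,x> = 0
                               (all f <m,x>, m < n, defined and nonzero). *)
Inductive eval (A : set) : nat -> nat -> nat -> Prop :=
| ev_zero k x : eval A (10 * k) x 0
| ev_succ k x : eval A (10 * k + 1) x (S x)
| ev_id k x : eval A (10 * k + 2) x x
| ev_left k a b : eval A (10 * k + 3) (npair a b) a
| ev_right k a b : eval A (10 * k + 4) (npair a b) b
| ev_orc_in k x : A x -> eval A (10 * k + 5) x 1
| ev_orc_out k x : ~ A x -> eval A (10 * k + 5) x 0
| ev_comp f g x y z :
    eval A g x y -> eval A f y z -> eval A (10 * npair f g + 6) x z
| ev_pair f g x y z :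
    eval A f x y -> eval A g x z -> eval A (10 * npair f g + 7) x (npair y z)
| ev_prec0 f g x y :
    eval A f x y -> eval A (10 * npair f g + 8) (npair 0 x) y
| ev_precS f g n x z y :
    eval A (10 * npair f g + 8) (npair n x) z ->
    eval A g (npair (npair n z) x) y ->
    eval A (10 * npair f g + 8) (npair (S n) x) y
| ev_min f x y : msearch A f x 0 y -> eval A (10 * f + 9) x y
with msearch (A : set) : nat -> nat -> nat -> nat -> Prop :=
| ms_found f x n : eval A f (npair n x) 0 -> msearch A f x n n
| ms_next f x n k y :
    eval A f (npair n x) (S k) -> msearch A f x (S n) y -> msearch A f x n y.

Definition Turing_le (X Y : set) : Prop :=
  exists e, forall n, (X n -> eval Y e n 1) /\ (~ X n -> eval Y e n 0).

Definition computable (X : set) : Prop := Turing_le X empty_set.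

Definition jump (A : set) : set := fun e => exists y, eval A e e y.

Definition low2 (X : set) : Prop :=
  Turing_le (jump (jump X)) (jump (jump empty_set)).

(** * Arithmetical formulas with two set parameters X, Y
    (number variables are de Bruijn indices). *)
Inductive term : Type :=
| tvar (i : nat)
| tzero
| tsucc (t : term)
| tadd (t u : term)
| tmul (t u : term).

Inductive form : Type :=
| fmemX (t : term)
| fmemY (t : term)
| feq (t u : term)
| flt (t u : term)
| fnot (p : form)
| fand (p q : form)
| f_or (p q : form)
| fimp (p q : form)
| fall (p : form)
| fex (p : form).

Fixpoint teval (env : nat -> nat) (t : term) : nat :=
  match t with
  | tvar i => env i
  | tzero => 0
  | tsucc t => S (teval env t)
  | tadd t u => teval env t + teval env u
  | tmul t u => teval env t * teval env u
  end.

Definition scons (n : nat) (env : nat -> nat) : nat -> nat :=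
  fun i => match i with 0 => n | S j => env j end.

Fixpoint holds (X Y : set) (env : nat -> nat) (p : form) : Prop :=
  match p with
  | fmemX t => X (teval env t)
  | fmemY t => Y (teval env t)
  | feq t u => teval env t = teval env u
  | flt t u => teval env t < teval env u
  | fnot p => ~ holds X Y env p
  | fand p q => holds X Y env p /\ holds X Y env q
  | f_or p q => holds X Y env p \/ holds X Y env q
  | fimp p q => holds X Y env p -> holds X Y env q
  | fall p => forall n, holds X Y (scons n env) p
  | fex p => exists n, holds X Y (scons n env) p
  end.

Definition env0 : nat -> nat := fun _ => 0.

Definition arithmetical1 (Phi : set -> Prop) : Prop :=
  exists p : form, forall X, Phi X <-> holds X empty_set env0 p.

Definition arithmetical2 (Psi : set -> set -> Prop) : Prop :=
  exists p : form, forall X Y, Psi X Y <-> holds X Y env0 p.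

(** * Principles:  forall X (Phi X -> exists Y, Psi X Y). *)
Record principle : Type := Principle {
  instance : set -> Prop;
  solution : set -> set -> Prop  (* Psi : solution X Y = "Y solves X" *)
}.

Definition arithmetical_principle (P : principle) : Prop :=
  arithmetical1 (instance P) /\ arithmetical2 (solution P).

(** A degree (represented by a set D) bounds P. *)
Definition bounds (D : set) (P : principle) : Prop :=
  forall X, computable X -> instance P X ->
    exists Y, Turing_le Y D /\ solution P X Y.

Definition admits_universal_instance (P : principle) : Prop :=
  exists X, computable X /\ instance P X /\
    forall Y, solution P X Y -> bounds Y P.

Definition c_reducible (P Q : principle) : Prop :=
  forall X, instance P X ->
    exists Y, Turing_le Y X /\ instance Q Y /\
      forall Z, solution Q Y Z ->
        exists W, Turing_le W (join X Z) /\ solution P X W.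

Definition omega_model (P : principle) (M : set -> Prop) : Prop :=
  (exists X, M X) /\
  (forall X Y, M X -> M Y -> M (join X Y)) /\
  (forall X Y, M Y -> Turing_le X Y -> M X) /\
  (forall X, M X -> instance P X -> exists Y, M Y /\ solution P X Y).

(** * STS(2)
   An instance is (the graph of) g : [omega]^2 -> omega, coded as the set
   G with  npair (npair x s) v \in G  iff  x < s and g(x,s) = v. *)
Definition graph_val (G : set) (x s v : nat) : Prop := G (npair (npair x s) v).

Definition STS2_instance (G : set) : Prop :=
  (forall x s v, graph_val G x s v -> x < s) /\
  (forall x s, x < s -> exists v, graph_val G x s v) /\
  (forall x s v w, graph_val G x s v -> graph_val G x s w -> v = w) /\
  (forall n, (forall x s v, n <> npair (npair x s) v) -> ~ G n) /\
  (forall x, exists v s0, forall s, s0 < s -> x < s -> graph_val G x s v).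

Definition STS2_solution (G A : set) : Prop :=
  infinite A /\
  exists v, forall x y, A x -> A y -> x < y -> ~ graph_val G x y v.

Definition STS2 : principle := Principle STS2_instance STS2_solution.

(** * SADS
   An instance is a linear order on omega coded as the set L with
   npair a b \in L iff a <=_L b. *)
Definition lo_le (L : set) (a b : nat) : Prop := L (npair a b).
Definition lo_lt (L : set) (a b : nat) : Prop := lo_le L a b /\ a <> b.

Definition SADS_instance (L : set) : Prop :=
  (forall n, (forall a b, n <> npair a b) -> ~ L n) /\
  (forall a, lo_le L a a) /\
  (forall a b, lo_le L a b -> lo_le L b a -> a = b) /\
  (forall a b c, lo_le L a b -> lo_le L b c -> lo_le L a c) /\
  (forall a b, lo_le L a b \/ lo_le L b a) /\
  (forall a, (exists m, forall b, lo_lt L b a -> b < m) \/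
             (exists m, forall b, lo_lt L a b -> b < m)).

(** An infinite ascending (resp. descending) sequence: an infinite set S on
    which <_L agrees with (resp. reverses) the usual order. *)
Definition SADS_solution (L S : set) : Prop :=
  infinite S /\
  ((forall x y, S x -> S y -> x < y -> lo_lt L x y) \/
   (forall x y, S x -> S y -> x < y -> lo_lt L y x)).

Definition SADS : principle := Principle SADS_instance SADS_solution.

(* Main.v *)
(* If X is low2, then X'' is a limit of limits of a computable function c by two
   applications of the limit lemma. Let G be a computable function on pairs. That a
   given X-computable set A is infinite and omits the value v on pairs under G is a
   Pi_2(X) condition, so its truth is read off X'' and hence guessed by c. By the
   recursion theorem G may use guesses about itself: at (x,s) it takes the least
   requirement (A,v) below x whose condition is currently believed at stage (x,s), and
   answers v. Were some condition true, the first true one would be believed for almost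
   all x in the limit, so that G(x,s) = v for almost all x and then almost all s, and A
   would not omit v. Hence no condition is true, while G is stable because for fixed x
   only finitely many convergent guesses matter.

   For STS(2) this G is the instance. For SADS the guesses are bits D(k,s); element s is
   placed at the node (D(0,s), ..., D(s-1,s)) of the binary tree and the elements are
   ordered by in-order traversal, so that for x < s the order of x and s is decided by
   the bit of s at the level where the two nodes split.

   Finally, a solution in the omega-model of a universal instance would be a low2 set
   bounding P, and thus computing solutions to all computable instances of STS(2) or of
   SADS. *)

Require Import Defs.
From Stdlib Require Import Arith Lia Bool Classical ClassicalEpsilon.

(** * Pairing *)

(** Walks along the antidiagonals in the order of the polynomial [npair], so the inversion goes by
    induction and not through square roots. *)
Fixpoint unpair (n : nat) : nat * nat :=
  match n with
  | 0 => (0, 0)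
  | S m => match unpair m with
           | (0, y) => (S y, 0)
           | (S x, y) => (x, S y)
           end
  end.

Definition pl (n : nat) : nat := fst (unpair n).
Definition pr (n : nat) : nat := snd (unpair n).

Lemma npair_next_row (y : nat) : npair (S y) 0 = S (npair 0 y).
Proof.
  unfold npair.
  replace ((S y + 0) * (S y + 0 + 1)) with ((0 + y) * (0 + y + 1) + S y * 2) by ring.
  rewrite Nat.div_add by lia. lia.
Qed.

Lemma npair_next (x y : nat) : npair x (S y) = S (npair (S x) y).
Proof. unfold npair. replace (x + S y) with (S x + y) by lia. lia. Qed.

Lemma npair_unpair (n : nat) : npair (pl n) (pr n) = n.
Proof.
  unfold pl, pr. induction n as [|n IH]; [reflexivity|]. simpl.
  destruct (unpair n) as [[|x] y]; simpl in *.
  - now rewrite npair_next_row, IH.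
  - now rewrite npair_next, IH.
Qed.

Lemma unpair_npair (x y : nat) : unpair (npair x y) = (x, y).
Proof.
  remember (x + y) as m eqn:Hm. revert x y Hm.
  induction m as [|m IHm]; intros x y Hm.
  - now replace x with 0 by lia; replace y with 0 by lia.
  - revert x Hm. induction y as [|y IHy]; intros x Hm.
    + replace x with (S m) by lia. rewrite npair_next_row. simpl. now rewrite IHm.
    + rewrite npair_next. simpl. now rewrite IHy by lia.
Qed.

Lemma pl_npair (x y : nat) : pl (npair x y) = x.
Proof. unfold pl. now rewrite unpair_npair. Qed.

Lemma pr_npair (x y : nat) : pr (npair x y) = y.
Proof. unfold pr. now rewrite unpair_npair. Qed.

Lemma npair_ge_r (x y : nat) : y <= npair x y.
Proof. unfold npair. lia. Qed.

Lemma npair_ge_l (x y : nat) : x <= npair x y.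
Proof.
  induction x as [|x IH]; [lia|].
  assert (H : npair x y < npair (S x) y); [|lia].
  unfold npair. replace ((S x + y) * (S x + y + 1))
    with ((x + y) * (x + y + 1) + (x + y + 1) * 2) by ring.
  rewrite Nat.div_add by lia. lia.
Qed.

Lemma pl_le (n : nat) : pl n <= n.
Proof. rewrite <- (npair_unpair n) at 2. apply npair_ge_l. Qed.

Lemma pr_le (n : nat) : pr n <= n.
Proof. rewrite <- (npair_unpair n) at 2. apply npair_ge_r. Qed.

Opaque npair pl pr.

(** * Evaluation as a least fixed point *)

(* One unfolding of [eval], the recursive calls being answered by [Ev]; the minimisation
   search is flattened into a bounded quantifier. *)
Definition eval_step (A : set) (Ev : nat -> nat -> nat -> Prop) (e x y : nat) : Prop :=
  let k := e / 10 in
  match e mod 10 with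
  | 0 => y = 0
  | 1 => y = S x
  | 2 => y = x
  | 3 => y = pl x
  | 4 => y = pr x
  | 5 => (A x /\ y = 1) \/ (~ A x /\ y = 0)
  | 6 => exists z, Ev (pr k) x z /\ Ev (pl k) z y
  | 7 => Ev (pl k) x (pl y) /\ Ev (pr k) x (pr y)
  | 8 => match pl x with
         | 0 => Ev (pl k) (pr x) y
         | S n => exists z, Ev e (npair n (pr x)) z /\
                            Ev (pr k) (npair (npair n z) (pr x)) y
         end
  | _ => Ev k (npair y x) 0 /\ forall m, m < y -> exists z, Ev k (npair m x) (S z)
  end.

Lemma eval_step_mono (A : set) (E1 E2 : nat -> nat -> nat -> Prop) :
  (forall e x y, E1 e x y -> E2 e x y) ->
  forall e x y, eval_step A E1 e x y -> eval_step A E2 e x y.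
Proof.
  intros H e x y. unfold eval_step.
  destruct (e mod 10) as [|[|[|[|[|[|[|[|[|r]]]]]]]]]; auto.
  - intros (z & ? & ?); eauto.
  - intros []; auto.
  - destruct (pl x); auto. intros (z & ? & ?); eauto.
  - intros [? Hm]; split; auto. intros m Hy. destruct (Hm m Hy); eauto.
Qed.

Lemma code_div (k r : nat) : r < 10 -> (10 * k + r) / 10 = k.
Proof.
  intros H. rewrite Nat.mul_comm, Nat.div_add_l, Nat.div_small by lia. lia.
Qed.

Lemma code_mod (k r : nat) : r < 10 -> (10 * k + r) mod 10 = r.
Proof.
  intros H. rewrite Nat.add_comm, Nat.mul_comm, Nat.Div0.mod_add.
  now apply Nat.mod_small.
Qed.

Scheme eval_mut := Minimality for eval Sort Prop
  with msearch_mut := Minimality for msearch Sort Prop.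

Lemma eval_least (A : set) (P : nat -> nat -> nat -> Prop) :
  (forall e x y, eval_step A P e x y -> P e x y) ->
  forall e x y, eval A e x y -> P e x y.
Proof.
  intros H.
  (* The motive for [msearch] is the flattened search started at [n]; at [n = 0] it is the last
     clause of [eval_step]. *)
  apply (eval_mut A P (fun f x n y => n <= y /\ P f (npair y x) 0 /\
      forall m, n <= m -> m < y -> exists z, P f (npair m x) (S z)));
    intros; try (apply H; unfold eval_step;
      match goal with
      | |- context [(10 * ?k) mod 10] => rewrite <- (Nat.add_0_r (10 * k))
      | _ => idtac
      end;
      rewrite code_mod, ?code_div, ?pl_npair, ?pr_npair by lia; cbv iota beta zeta;
      rewrite ?pl_npair, ?pr_npair; eauto; fail).
  - apply H. unfold eval_step. rewrite code_mod, ?code_div by lia; cbv iota beta zeta.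
    destruct H1 as (_ & ? & H1). split; auto. intros m Hm. apply H1; lia.
  - repeat split; auto. intros; lia.
  - destruct H3 as (Hle & H4 & H5). repeat split; [lia|auto|].
    intros m Hm Hy. destruct (Nat.eq_dec m n) as [->|Hne]; eauto. apply H5; lia.
Qed.

Lemma eval_intro (A : set) (e x y : nat) : eval_step A (eval A) e x y -> eval A e x y.
Proof.
  unfold eval_step. assert (He : e = 10 * (e / 10) + e mod 10) by apply Nat.div_mod_eq.
  assert (Hr : e mod 10 < 10) by (apply Nat.mod_upper_bound; lia).
  set (k := e / 10) in *. set (r := e mod 10) in *. clearbody k r.
  rewrite He.
  destruct r as [|[|[|[|[|[|[|[|[|[|r]]]]]]]]]]; cbv zeta iota; [..|lia].
  - intros ->. rewrite Nat.add_0_r. constructor.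
  - intros ->. constructor.
  - intros ->. constructor.
  - intros ->. rewrite <- (npair_unpair x) at 1. constructor.
  - intros ->. rewrite <- (npair_unpair x) at 1. constructor.
  - intros [[? ->]|[? ->]]; now constructor.
  - intros (z & ? & ?). rewrite <- (npair_unpair k). econstructor; eauto.
  - intros []. rewrite <- (npair_unpair k), <- (npair_unpair y). now constructor.
  - destruct (pl x) as [|n] eqn:Ex; rewrite <- (npair_unpair x), Ex, pr_npair.
    + rewrite <- (npair_unpair k), pl_npair. now constructor.
    + rewrite <- (npair_unpair k), pr_npair. intros (z & ? & ?). econstructor; eauto.
  - intros [H0 Hm]. constructor.
    (* The search is rebuilt backwards from its result: [d] counts the candidates still to be
       rejected before [y]. *)
    assert (Hs : forall d, d <= y -> msearch A k x (y - d) y).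
    { induction d as [|d IH]; intros Hd.
      - rewrite Nat.sub_0_r. now constructor.
      - destruct (Hm (y - S d)) as [z Hz]; [lia|]. econstructor; eauto.
        replace (S (y - S d)) with (y - d) by lia. apply IH; lia. }
    replace 0 with (y - y) by lia. now apply Hs.
Qed.

Lemma eval_inv (A : set) (e x y : nat) : eval A e x y -> eval_step A (eval A) e x y.
Proof.
  revert e x y. apply eval_least. intros e x y.
  apply eval_step_mono. exact (eval_intro A).
Qed.

(** [eval_least] applied to the conjunction of [eval] and [P], so that induction hypotheses come
    together with the subcomputations they concern. *)
Lemma eval_induction (A : set) (P : nat -> nat -> nat -> Prop) :
  (forall e x y, eval_step A (fun e x y => eval A e x y /\ P e x y) e x y -> P e x y) ->
  forall e x y, eval A e x y -> P e x y.
Proof.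
  intros H e x y He. cut (eval A e x y /\ P e x y); [tauto|].
  revert e x y He. apply eval_least. intros e x y Hs. split; auto.
  apply eval_intro. revert Hs. apply eval_step_mono. tauto.
Qed.

Lemma eval_fun (A : set) (e x y z : nat) : eval A e x y -> eval A e x z -> y = z.
Proof.
  intros H. revert z. revert e x y H.
  apply (eval_induction A (fun e x y => forall z, eval A e x z -> y = z)).
  intros e x y H z Hz. apply eval_inv in Hz. unfold eval_step in *.
  destruct (e mod 10) as [|[|[|[|[|[|[|[|[|r]]]]]]]]]; try congruence.
  - intuition congruence.
  - destruct H as (u & [_ Hu] & [_ Hy]), Hz as (v & Hv & Hz).
    apply Hu in Hv as <-. auto.
  - destruct H as [[_ H1] [_ H2]], Hz as [Hz1 Hz2].
    apply H1 in Hz1. apply H2 in Hz2. rewrite <- (npair_unpair y), <- (npair_unpair z).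
    congruence.
  - destruct (pl x).
    + destruct H; auto.
    + destruct H as (u & [_ Hu] & [_ Hy]), Hz as (v & Hv & Hz).
      apply Hu in Hv as <-. auto.
  - destruct H as [[_ H1] H2], Hz as [Hz1 Hz2].
    destruct (Nat.lt_trichotomy y z) as [Hyz|[Hyz|Hyz]]; auto; exfalso.
    + destruct (Hz2 y Hyz) as [u Hu]. apply H1 in Hu. discriminate.
    + destruct (H2 z Hyz) as [u [_ Hu]]. apply Hu in Hz1. discriminate.
Qed.

(** * Program constructors and unbounded search *)

Definition c_comp (f g : nat) : nat := 10 * npair f g + 6.
Definition c_pair (f g : nat) : nat := 10 * npair f g + 7.
Definition c_min (f : nat) : nat := 10 * f + 9.

Fixpoint c_const (n : nat) : nat :=
  match n with
  | 0 => 0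
  | S m => c_comp 1 (c_const m)
  end.

Lemma eval_const (A : set) (n x : nat) : eval A (c_const n) x n.
Proof.
  induction n as [|n IH]; simpl.
  - apply (ev_zero A 0).
  - econstructor; [exact IH | apply (ev_succ A 0)].
Qed.

Lemma eval_id (A : set) (x : nat) : eval A 2 x x.
Proof. apply (ev_id A 0). Qed.

Lemma eval_left (A : set) (x : nat) : eval A 3 x (pl x).
Proof. rewrite <- (npair_unpair x) at 1. apply (ev_left A 0). Qed.

Lemma eval_right (A : set) (x : nat) : eval A 4 x (pr x).
Proof. rewrite <- (npair_unpair x) at 1. apply (ev_right A 0). Qed.

Lemma eval_comp_inv (A : set) (f g x y : nat) :
  eval A (c_comp f g) x y -> exists z, eval A g x z /\ eval A f z y.
Proof.
  intros H. apply eval_inv in H. unfold eval_step, c_comp in H.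
  now rewrite code_mod, code_div, pl_npair, pr_npair in H by lia.
Qed.

Lemma eval_pair_inv (A : set) (f g x y : nat) :
  eval A (c_pair f g) x y -> eval A f x (pl y) /\ eval A g x (pr y).
Proof.
  intros H. apply eval_inv in H. unfold eval_step, c_pair in H.
  now rewrite code_mod, code_div, pl_npair, pr_npair in H by lia.
Qed.

Lemma eval_min_inv (A : set) (f x y : nat) :
  eval A (c_min f) x y -> eval A f (npair y x) 0.
Proof.
  intros H. apply eval_inv in H. unfold eval_step, c_min in H.
  rewrite code_mod, code_div in H by lia. apply H.
Qed.

Lemma least_witness (P : nat -> Prop) (n : nat) :
  P n -> exists m, P m /\ forall k, k < m -> ~ P k.
Proof.
  induction n as [n IH] using lt_wf_ind. intros Hn.
  destruct (classic (exists k, k < n /\ P k)) as [(k & Hk & Pk)|Hno].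
  - eauto.
  - exists n. split; auto. intros k Hk Pk. apply Hno. eauto.
Qed.

Lemma eval_min_total (A : set) (f x n : nat) (F : nat -> nat) :
  (forall m, eval A f (npair m x) (F m)) -> F n = 0 -> exists y, eval A (c_min f) x y.
Proof.
  intros HF Hn. destruct (least_witness (fun m => F m = 0) n Hn) as (m & Hm & Hl).
  exists m. apply eval_intro. unfold eval_step, c_min.
  rewrite code_mod, code_div by lia. split.
  - rewrite <- Hm. apply HF.
  - intros k Hk. exists (pred (F k)). specialize (Hl k Hk).
    replace (S (pred (F k))) with (F k) by lia. apply HF.
Qed.

(** * Functions computable uniformly in a class of oracles *)

(** One program must serve all oracles of the class: [eq A] gives computability from [A], and
    [every] gives computable functions with a program insensitive to its oracle. *)
Definition rec (AA : set -> Prop) (f : nat -> nat) : Prop :=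
  exists e, forall A, AA A -> forall n, eval A e n (f n).

Definition recb (AA : set -> Prop) (P : nat -> bool) : Prop :=
  rec AA (fun n => Nat.b2n (P n)).

Definition every : set -> Prop := fun _ => True.

Definition chi (A : set) (n : nat) : bool :=
  if excluded_middle_informative (A n) then true else false.

Lemma chi_true (A : set) (n : nat) : chi A n = true <-> A n.
Proof. unfold chi. destruct (excluded_middle_informative (A n)); intuition congruence. Qed.

Lemma chi_false (A : set) (n : nat) : chi A n = false <-> ~ A n.
Proof. unfold chi. destruct (excluded_middle_informative (A n)); intuition congruence. Qed.

Lemma Turing_le_rec (X Y : set) : Turing_le X Y <-> recb (eq Y) (chi X).
Proof.
  split.
  - intros [e He]. exists e. intros A <- n. destruct (chi X n) eqn:E.
    + apply He. now apply chi_true.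
    + apply He. now apply chi_false.
  - intros [e He]. exists e. intros n. specialize (He Y eq_refl n). split; intros H.
    + now rewrite (proj2 (chi_true X n)) in He.
    + now rewrite (proj2 (chi_false X n)) in He.
Qed.

(** * Primitive recursion and bounded search *)

Fixpoint nrec (b : nat) (g : nat -> nat -> nat) (n : nat) : nat :=
  match n with
  | 0 => b
  | S m => g m (nrec b g m)
  end.

(* Least [k < n] satisfying [P], or [n] if there is none. *)
Fixpoint bmin (P : nat -> bool) (n : nat) : nat :=
  match n with
  | 0 => 0
  | S m => if bmin P m <? m then bmin P m else if P m then m else S m
  end.

Definition bex (P : nat -> bool) (n : nat) : bool := bmin P n <? n.
Definition ball (P : nat -> bool) (n : nat) : bool := negb (bex (fun k => negb (P k)) n).

Lemma bmin_le (P : nat -> bool) (n : nat) : bmin P n <= n.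
Proof.
  induction n as [|n IH]; simpl; [lia|].
  destruct (bmin P n <? n); [lia|]. destruct (P n); lia.
Qed.

Lemma bmin_sat (P : nat -> bool) (n : nat) : bmin P n < n -> P (bmin P n) = true.
Proof.
  induction n as [|n IH]; simpl; [lia|].
  destruct (bmin P n <? n) eqn:E; intros H.
  - apply Nat.ltb_lt in E. auto.
  - destruct (P n) eqn:E2; [auto|lia].
Qed.

Lemma bmin_min (P : nat -> bool) (n k : nat) : k < bmin P n -> P k = false.
Proof.
  revert k. induction n as [|n IH]; simpl; intros k; [lia|].
  destruct (bmin P n <? n) eqn:E.
  - auto.
  - apply Nat.ltb_ge in E. assert (H := bmin_le P n). destruct (P n) eqn:E2; intros Hk.
    + apply IH. lia.
    + destruct (Nat.eq_dec k n) as [->|Hne]; [auto|]. apply IH. lia.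
Qed.

Lemma bmin_unique (P : nat -> bool) (n k : nat) :
  k <= n -> (k < n -> P k = true) -> (forall j, j < k -> P j = false) -> bmin P n = k.
Proof.
  intros Hk Hs Hm. assert (Hle := bmin_le P n).
  destruct (Nat.lt_trichotomy (bmin P n) k) as [H|[H|H]]; auto; exfalso.
  - assert (H1 := bmin_sat P n). rewrite Hm in H1 by auto. specialize (H1 ltac:(lia)). discriminate.
  - apply bmin_min in H as H1. rewrite Hs in H1 by lia. discriminate.
Qed.

Lemma bmin_ext (P Q : nat -> bool) (n : nat) :
  (forall k, k < n -> P k = Q k) -> bmin P n = bmin Q n.
Proof.
  induction n as [|n IH]; simpl; intros H; auto.
  rewrite IH by auto. now rewrite H by lia.
Qed.

Lemma bex_true (P : nat -> bool) (n : nat) :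
  bex P n = true <-> exists k, k < n /\ P k = true.
Proof.
  unfold bex. rewrite Nat.ltb_lt. split.
  - intros H. eauto using bmin_sat.
  - intros (k & Hk & HP). destruct (Nat.le_gt_cases n (bmin P n)) as [H|H]; auto.
    assert (Hc : P k = false) by (apply bmin_min with n; lia). congruence.
Qed.

Lemma ball_true (P : nat -> bool) (n : nat) :
  ball P n = true <-> forall k, k < n -> P k = true.
Proof.
  unfold ball. rewrite negb_true_iff, <- not_true_iff_false, bex_true. split.
  - intros H k Hk. destruct (P k) eqn:E; auto. destruct H. exists k. now rewrite E.
  - intros H (k & Hk & HP). rewrite H in HP by auto. discriminate.
Qed.

Section Closure.

Variable AA : set -> Prop.

Lemma rec_ext (f g : nat -> nat) : (forall n, f n = g n) -> rec AA f -> rec AA g.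
Proof. intros H [e He]. exists e. intros A HA n. rewrite <- H. auto. Qed.

Lemma rec_id : rec AA (fun n => n).
Proof. exists 2. intros. apply eval_id. Qed.

Lemma rec_const (k : nat) : rec AA (fun _ => k).
Proof. exists (c_const k). intros. apply eval_const. Qed.

Lemma rec_comp (f g : nat -> nat) : rec AA f -> rec AA g -> rec AA (fun n => f (g n)).
Proof. intros [e He] [d Hd]. exists (c_comp e d). intros. econstructor; eauto. Qed.

Lemma recb_comp (f : nat -> bool) (g : nat -> nat) :
  recb AA f -> rec AA g -> recb AA (fun n => f (g n)).
Proof. apply (rec_comp (fun n => Nat.b2n (f n))). Qed.

Lemma rec_npair (f g : nat -> nat) :
  rec AA f -> rec AA g -> rec AA (fun n => npair (f n) (g n)).
Proof. intros [e He] [d Hd]. exists (c_pair e d). intros. constructor; eauto. Qed.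

Lemma rec_pl (f : nat -> nat) : rec AA f -> rec AA (fun n => pl (f n)).
Proof. apply (rec_comp pl). exists 3. intros. apply eval_left. Qed.

Lemma rec_pr (f : nat -> nat) : rec AA f -> rec AA (fun n => pr (f n)).
Proof. apply (rec_comp pr). exists 4. intros. apply eval_right. Qed.

Lemma rec_S (f : nat -> nat) : rec AA f -> rec AA (fun n => S (f n)).
Proof. apply (rec_comp S). exists 1. intros. apply (ev_succ A 0). Qed.

(** The hypothesis on [g] decodes the argument [npair (npair m z) c] that the recursion clause of
    [eval] passes on, with [c] as the fixed parameter. *)
Lemma rec_nrec (b n : nat -> nat) (g : nat -> nat -> nat -> nat) :
  rec AA b -> rec AA n -> rec AA (fun p => g (pr p) (pl (pl p)) (pr (pl p))) ->
  rec AA (fun c => nrec (b c) (g c) (n c)).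
Proof.
  intros [eb Hb] [en Hn] [eg Hg].
  exists (c_comp (10 * npair eb eg + 8) (c_pair en 2)). intros A HA c.
  econstructor; [constructor; [now apply Hn | apply eval_id]|].
  induction (n c) as [|m IH]; simpl.
  - constructor. auto.
  - econstructor; [exact IH|].
    assert (H := Hg A HA (npair (npair m (nrec (b c) (g c) m)) c)).
    cbv beta in H. rewrite pl_npair, pr_npair, pl_npair, pr_npair in H. exact H.
Qed.

Lemma rec_pred (f : nat -> nat) : rec AA f -> rec AA (fun n => pred (f n)).
Proof.
  intros H. apply rec_ext with (fun c => nrec 0 (fun m _ => m) (f c)).
  - intros c. now destruct (f c).
  - apply (rec_nrec (fun _ => 0) f (fun _ m _ => m));
      auto using rec_const, rec_pl, rec_id.
Qed.

Lemma rec_add (f g : nat -> nat) : rec AA f -> rec AA g -> rec AA (fun n => f n + g n).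
Proof.
  intros Hf Hg. apply rec_ext with (fun c => nrec (f c) (fun _ z => S z) (g c)).
  - intros c. induction (g c); simpl; lia.
  - apply (rec_nrec f g (fun _ _ z => S z)); auto using rec_S, rec_pl, rec_pr, rec_id.
Qed.

Lemma rec_sub (f g : nat -> nat) : rec AA f -> rec AA g -> rec AA (fun n => f n - g n).
Proof.
  intros Hf Hg. apply rec_ext with (fun c => nrec (f c) (fun _ z => pred z) (g c)).
  - intros c. induction (g c); simpl; lia.
  - apply (rec_nrec f g (fun _ _ z => pred z)); auto using rec_pred, rec_pl, rec_pr, rec_id.
Qed.

Lemma rec_mul (f g : nat -> nat) : rec AA f -> rec AA g -> rec AA (fun n => f n * g n).
Proof.
  intros Hf Hg. apply rec_ext with (fun c => nrec 0 (fun _ z => z + f c) (g c)).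
  - intros c. induction (g c); simpl; lia.
  - apply (rec_nrec (fun _ => 0) g (fun c _ z => z + f c)); auto using rec_const.
    apply rec_add; auto using rec_pl, rec_pr, rec_id. apply rec_comp; auto using rec_pr, rec_id.
Qed.

Lemma rec_comp3 (D : nat -> nat -> nat -> nat) (f g h : nat -> nat) :
  rec AA (fun p => D (pl p) (pl (pr p)) (pr (pr p))) ->
  rec AA f -> rec AA g -> rec AA h -> rec AA (fun n => D (f n) (g n) (h n)).
Proof.
  intros HD Hf Hg Hh.
  apply rec_ext with (fun c => (fun p => D (pl p) (pl (pr p)) (pr (pr p)))
    (npair (f c) (npair (g c) (h c)))).
  - intros c. now rewrite !pr_npair, !pl_npair.
  - apply (rec_comp _ _ HD). auto using rec_npair.
Qed.

(** A conditional is a recursion of length 0 or 1 that starts from [g] and is overwritten by [f]. *)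
Lemma rec_if (b : nat -> bool) (f g : nat -> nat) :
  recb AA b -> rec AA f -> rec AA g -> rec AA (fun n => if b n then f n else g n).
Proof.
  intros Hb Hf Hg. apply rec_ext with (fun c => nrec (g c) (fun _ _ => f c) (Nat.b2n (b c))).
  - intros c. now destruct (b c).
  - apply (rec_nrec g (fun c => Nat.b2n (b c)) (fun c _ _ => f c)); auto.
    apply rec_comp; auto using rec_pr, rec_id.
Qed.

Lemma recb_if (b f g : nat -> bool) :
  recb AA b -> recb AA f -> recb AA g -> recb AA (fun n => if b n then f n else g n).
Proof.
  intros Hb Hf Hg.
  apply rec_ext with (fun c => if b c then Nat.b2n (f c) else Nat.b2n (g c)).
  - intros c. now destruct (b c).
  - now apply rec_if.
Qed.

Lemma recb_const (b : bool) : recb AA (fun _ => b).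
Proof. exact (rec_const (Nat.b2n b)). Qed.

Lemma recb_comp2 (P : nat -> nat -> bool) (f g : nat -> nat) :
  recb AA (fun p => P (pr p) (pl p)) -> rec AA f -> rec AA g ->
  recb AA (fun n => P (f n) (g n)).
Proof.
  intros HP Hf Hg.
  apply rec_ext with (fun c => (fun p => Nat.b2n (P (pr p) (pl p))) (npair (g c) (f c))).
  - intros c. now rewrite pl_npair, pr_npair.
  - apply (recb_comp _ _ HP). now apply rec_npair.
Qed.

Lemma recb_neg (f : nat -> bool) : recb AA f -> recb AA (fun n => negb (f n)).
Proof. intros H. apply (recb_if f); auto using recb_const. Qed.

Lemma recb_and (f g : nat -> bool) :
  recb AA f -> recb AA g -> recb AA (fun n => f n && g n).
Proof. intros Hf Hg. apply (recb_if f); auto using recb_const. Qed.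

Lemma recb_or (f g : nat -> bool) :
  recb AA f -> recb AA g -> recb AA (fun n => f n || g n).
Proof. intros Hf Hg. apply (recb_if f); auto using recb_const. Qed.

Lemma recb_ltb (f g : nat -> nat) :
  rec AA f -> rec AA g -> recb AA (fun n => f n <? g n).
Proof.
  intros Hf Hg. apply rec_ext with (fun c => nrec 0 (fun _ _ => 1) (g c - f c)).
  - intros c. destruct (f c <? g c) eqn:E.
    + apply Nat.ltb_lt in E. now replace (g c - f c) with (S (pred (g c - f c))) by lia.
    + apply Nat.ltb_ge in E. now replace (g c - f c) with 0 by lia.
  - apply (rec_nrec (fun _ => 0) (fun c => g c - f c) (fun _ _ _ => 1));
      auto using rec_const, rec_sub.
Qed.

Lemma recb_eqb (f g : nat -> nat) :
  rec AA f -> rec AA g -> recb AA (fun n => f n =? g n).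
Proof.
  intros Hf Hg. apply rec_ext with (fun c => Nat.b2n (negb (f c <? g c) && negb (g c <? f c))).
  - intros c. f_equal. apply eq_true_iff_eq.
    rewrite andb_true_iff, !negb_true_iff, !Nat.ltb_ge, Nat.eqb_eq. lia.
  - apply recb_and; apply recb_neg; now apply recb_ltb.
Qed.

Lemma rec_bmin (P : nat -> nat -> bool) (n : nat -> nat) :
  recb AA (fun p => P (pr p) (pl p)) -> rec AA n -> rec AA (fun c => bmin (P c) (n c)).
Proof.
  intros HP Hn.
  apply rec_ext with (fun c =>
    nrec 0 (fun m z => if z <? m then z else if P c m then m else S m) (n c)).
  - intros c. induction (n c) as [|m IH]; simpl; auto. now rewrite IH.
  - apply (rec_nrec (fun _ => 0) n
      (fun c m z => if z <? m then z else if P c m then m else S m)); auto using rec_const.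
    apply rec_if; [apply recb_ltb; auto using rec_pl, rec_pr, rec_id|
      auto using rec_pl, rec_pr, rec_id|].
    apply (rec_if (fun p => P (pr p) (pl (pl p)))); auto using rec_S, rec_pl, rec_pr, rec_id.
    apply (recb_comp2 P pr (fun p => pl (pl p))); auto using rec_pl, rec_pr, rec_id.
Qed.

Lemma recb_bex (P : nat -> nat -> bool) (n : nat -> nat) :
  recb AA (fun p => P (pr p) (pl p)) -> rec AA n -> recb AA (fun c => bex (P c) (n c)).
Proof. intros HP Hn. apply recb_ltb; auto. now apply rec_bmin. Qed.

Lemma recb_ball (P : nat -> nat -> bool) (n : nat -> nat) :
  recb AA (fun p => P (pr p) (pl p)) -> rec AA n -> recb AA (fun c => ball (P c) (n c)).
Proof.
  intros HP Hn. apply recb_neg.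
  apply (recb_bex (fun c k => negb (P c k))); auto. now apply recb_neg.
Qed.

Lemma rec_div10 (f : nat -> nat) : rec AA f -> rec AA (fun n => f n / 10).
Proof.
  intros Hf. apply rec_ext with (fun c => bmin (fun q => f c <? 10 * S q) (f c)).
  - intros c. apply bmin_unique.
    + apply Nat.Div0.div_le_upper_bound; lia.
    + intros _. apply Nat.ltb_lt. apply Nat.mul_succ_div_gt. lia.
    + intros j Hj. apply Nat.ltb_ge.
      assert (H := Nat.Div0.mul_div_le (f c) 10). nia.
  - apply (rec_bmin (fun c q => f c <? 10 * S q)); auto. apply recb_ltb.
    + apply rec_comp; auto using rec_pr, rec_id.
    + apply rec_mul; auto using rec_const, rec_S, rec_pl, rec_id.
Qed.

Lemma rec_mod10 (f : nat -> nat) : rec AA f -> rec AA (fun n => f n mod 10).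
Proof.
  intros Hf. apply rec_ext with (fun c => f c - 10 * (f c / 10)).
  - intros c. now rewrite Nat.Div0.mod_eq.
  - apply rec_sub; auto. apply rec_mul; auto using rec_const, rec_div10.
Qed.

Lemma rec_c_const (f : nat -> nat) : rec AA f -> rec AA (fun n => c_const (f n)).
Proof.
  intros Hf. apply rec_ext with (fun c => nrec 0 (fun _ z => 10 * npair 1 z + 6) (f c)).
  - intros c. induction (f c) as [|n IH]; [reflexivity|]. cbn [nrec]. now rewrite IH.
  - apply (rec_nrec (fun _ => 0) f (fun _ _ z => 10 * npair 1 z + 6)); auto using rec_const.
    apply rec_add; [apply rec_mul|]; auto using rec_const.
    apply rec_npair; auto using rec_const, rec_pr, rec_pl, rec_id.
Qed.

Lemma rec_c_comp (f g : nat -> nat) :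
  rec AA f -> rec AA g -> rec AA (fun n => c_comp (f n) (g n)).
Proof.
  intros Hf Hg. apply rec_add; [apply rec_mul|]; auto using rec_const, rec_npair.
Qed.

Lemma rec_c_pair (f g : nat -> nat) :
  rec AA f -> rec AA g -> rec AA (fun n => c_pair (f n) (g n)).
Proof.
  intros Hf Hg. apply rec_add; [apply rec_mul|]; auto using rec_const, rec_npair.
Qed.

Lemma rec_c_min (f : nat -> nat) : rec AA f -> rec AA (fun n => c_min (f n)).
Proof. intros Hf. apply rec_add; [apply rec_mul|]; auto using rec_const. Qed.

End Closure.

(** Follows the syntax of the function body. The first two clauses use hypotheses on functions of
    two or three arguments, in the tupled form that [recb_comp2] and [rec_comp3] require. *)
Ltac rec_step :=
  match goal with
  | HP : recb ?AA (fun p => ?P (pr p) (pl p)) |- recb ?AA (fun c => ?P (@?f c) (@?g c)) =>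
      apply (recb_comp2 AA P f g HP)
  | HD : rec ?AA (fun p => ?D (pl p) (pl (pr p)) (pr (pr p)))
    |- rec ?AA (fun c => ?D (@?f c) (@?g c) (@?h c)) => apply (rec_comp3 AA D f g h HD)
  | |- rec _ (fun c => c) => apply rec_id
  | |- rec _ pl => apply (rec_pl _ (fun c => c))
  | |- rec _ pr => apply (rec_pr _ (fun c => c))
  | H : rec ?AA ?f |- rec ?AA (fun c => ?f (@?g c)) => apply (rec_comp AA f g H)
  | H : recb ?AA ?f |- recb ?AA (fun c => ?f (@?g c)) => apply (recb_comp AA f g H)
  | |- rec _ (fun _ => ?k) => apply rec_const
  | |- rec _ (fun c => npair (@?f c) (@?g c)) => apply (rec_npair _ f g)
  | |- rec _ (fun c => pl (@?f c)) => apply (rec_pl _ f)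
  | |- rec _ (fun c => pr (@?f c)) => apply (rec_pr _ f)
  | |- rec _ (fun c => S (@?f c)) => apply (rec_S _ f)
  | |- rec _ (fun c => pred (@?f c)) => apply (rec_pred _ f)
  | |- rec _ (fun c => @?f c + @?g c) => apply (rec_add _ f g)
  | |- rec _ (fun c => @?f c * @?g c) => apply (rec_mul _ f g)
  | |- rec _ (fun c => @?f c / 10) => apply (rec_div10 _ f)
  | |- rec _ (fun c => @?f c mod 10) => apply (rec_mod10 _ f)
  | |- rec _ (fun c => c_const (@?f c)) => apply (rec_c_const _ f)
  | |- rec _ (fun c => c_comp (@?f c) (@?g c)) => apply (rec_c_comp _ f g)
  | |- rec _ (fun c => c_pair (@?f c) (@?g c)) => apply (rec_c_pair _ f g)
  | |- rec _ (fun c => c_min (@?f c)) => apply (rec_c_min _ f)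
  | |- rec _ (fun c => bmin (@?P c) (@?n c)) => apply (rec_bmin _ P n)
  | |- rec _ (fun c => nrec (@?b c) (@?g c) (@?n c)) => apply (rec_nrec _ b n g)
  | |- rec _ (fun c => if @?b c then @?f c else @?g c) => apply (rec_if _ b f g)
  | |- rec ?AA (fun c => Nat.b2n (@?b c)) => change (recb AA b)
  | |- recb _ (fun _ => ?k) => apply recb_const
  | |- recb _ (fun c => bex (@?P c) (@?n c)) => apply (recb_bex _ P n)
  | |- recb _ (fun c => ball (@?P c) (@?n c)) => apply (recb_ball _ P n)
  | |- recb _ (fun c => @?f c =? @?g c) => apply (recb_eqb _ f g)
  | |- recb _ (fun c => @?f c <? @?g c) => apply (recb_ltb _ f g)
  | |- recb _ (fun c => @?f c && @?g c) => apply (recb_and _ f g)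
  | |- recb _ (fun c => @?f c || @?g c) => apply (recb_or _ f g)
  | |- recb _ (fun c => negb (@?f c)) => apply (recb_neg _ f)
  | |- recb _ (fun c => if @?b c then @?f c else @?g c) => apply (recb_if _ b f g)
  end; cbv beta.

Ltac rec_auto := cbv beta; repeat first [assumption | rec_step].

(** * Certificates of computations *)

(* A certificate is a coded list of triples [<e,<x,y>>] in which every entry follows
   from the entries after it by one clause of [eval]; the list with head [t] and tail
   [w] is the number [S (npair t w)], and 0 is the empty list. *)
Definition triple (e x y : nat) : nat := npair e (npair x y).
Definition hd (w : nat) : nat := pl (pred w).
Definition tl (w : nat) : nat := pr (pred w).
Definition suffix (w i : nat) : nat := nrec w (fun _ z => tl z) i.

Definition mem (t w : nat) : bool :=
  bex (fun i => (0 <? suffix w i) && (hd (suffix w i) =? t)) w.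

(** A decidable [eval_step] in which [w] answers the recursive calls. The witnesses [z] may be
    sought below [w], since the components of a listed triple are smaller than the code of the
    list. *)
Definition justified (O : nat -> bool) (t w : nat) : bool :=
  let e := pl t in let x := pl (pr t) in let y := pr (pr t) in
  let k := e / 10 in let r := e mod 10 in
  if r =? 0 then y =? 0 else
  if r =? 1 then y =? S x else
  if r =? 2 then y =? x else
  if r =? 3 then y =? pl x else
  if r =? 4 then y =? pr x else
  if r =? 5 then (if O x then y =? 1 else y =? 0) else
  if r =? 6 then bex (fun z => mem (triple (pr k) x z) w && mem (triple (pl k) z y) w) w else
  if r =? 7 then mem (triple (pl k) x (pl y)) w && mem (triple (pr k) x (pr y)) w else
  if r =? 8 then
    (if pl x =? 0 then mem (triple (pl k) (pr x) y) w
     else bex (fun z => mem (triple e (npair (pred (pl x)) (pr x)) z) w &&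
            mem (triple (pr k) (npair (npair (pred (pl x)) z) (pr x)) y) w) w)
  else mem (triple k (npair y x) 0) w &&
       ball (fun m => bex (fun z => mem (triple k (npair m x) (S z)) w) w) y.

Definition valid (O : nat -> bool) (w : nat) : bool :=
  ball (fun i => (suffix w i =? 0) || justified O (hd (suffix w i)) (tl (suffix w i))) w.

Lemma suffix_S (w i : nat) : suffix w (S i) = suffix (tl w) i.
Proof. induction i as [|i IH]; [reflexivity|]. unfold suffix in *. simpl in *. now rewrite IH. Qed.

Lemma tl_le (w : nat) : tl w <= pred w.
Proof. apply pr_le. Qed.

Lemma suffix_le (w i : nat) : suffix w i <= w - i.
Proof.
  induction i as [|i IH]; [unfold suffix; simpl; lia|].
  change (suffix w (S i)) with (tl (suffix w i)). assert (H := tl_le (suffix w i)). lia.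
Qed.

Lemma mem_iff (t w : nat) :
  mem t w = true <-> exists i, 0 < suffix w i /\ hd (suffix w i) = t.
Proof.
  unfold mem. rewrite bex_true. split.
  - intros (i & _ & H). apply andb_true_iff in H. rewrite Nat.ltb_lt, Nat.eqb_eq in H. eauto.
  - intros (i & H1 & H2). exists i. assert (H := suffix_le w i). split; [lia|].
    apply andb_true_iff. rewrite Nat.ltb_lt, Nat.eqb_eq. auto.
Qed.

Lemma mem_lt (t w : nat) : mem t w = true -> t < w.
Proof.
  rewrite mem_iff. intros (i & H & <-). assert (H1 := suffix_le w i).
  assert (H2 := pl_le (pred (suffix w i))). unfold hd. lia.
Qed.

Lemma mem_nonempty (t w : nat) :
  mem t w = true <-> 0 < w /\ (hd w = t \/ mem t (tl w) = true).
Proof.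
  rewrite !mem_iff. split.
  - intros ([|i] & H1 & H2).
    + change (suffix w 0) with w in *. auto.
    + assert (H := suffix_le w (S i)). split; [lia|]. right. exists i.
      now rewrite <- suffix_S.
  - intros (H & [H1|(i & H1 & H2)]).
    + now exists 0.
    + exists (S i). now rewrite suffix_S.
Qed.

Lemma valid_iff (O : nat -> bool) (w : nat) :
  valid O w = true <->
  forall i, suffix w i = 0 \/ justified O (hd (suffix w i)) (tl (suffix w i)) = true.
Proof.
  unfold valid. rewrite ball_true. split.
  - intros H i. destruct (Nat.lt_ge_cases i w) as [Hi|Hi].
    + apply H in Hi. now rewrite orb_true_iff, Nat.eqb_eq in Hi.
    + left. assert (H1 := suffix_le w i). lia.
  - intros H i _. now rewrite orb_true_iff, Nat.eqb_eq.
Qed.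

Lemma valid_nonempty (O : nat -> bool) (w : nat) : 0 < w ->
  (valid O w = true <-> justified O (hd w) (tl w) = true /\ valid O (tl w) = true).
Proof.
  intros Hw. rewrite !valid_iff. split.
  - intros H. split.
    + destruct (H 0) as [H0|H0]; [|exact H0]. change (suffix w 0) with w in H0. lia.
    + intros i. rewrite <- suffix_S. apply H.
  - intros [H1 H2] [|i]; [right; exact H1|]. rewrite suffix_S. apply H2.
Qed.

Lemma triple_bounds (e x y w : nat) :
  mem (triple e x y) w = true -> x < w /\ y < w.
Proof.
  intros H. apply mem_lt in H. unfold triple in H.
  assert (H1 := npair_ge_r e (npair x y)). assert (H2 := npair_ge_r x y).
  assert (H3 := npair_ge_l x y). lia.
Qed.

Lemma justified_iff (A : set) (e x y w : nat) :
  justified (chi A) (triple e x y) w = true <->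
  eval_step A (fun e x y => mem (triple e x y) w = true) e x y.
Proof.
  unfold justified, eval_step.
  assert (E1 : pl (triple e x y) = e) by apply pl_npair.
  assert (E2 : pr (triple e x y) = npair x y) by apply pr_npair.
  rewrite E1, E2, pl_npair, pr_npair. cbv zeta.
  destruct (e mod 10) as [|[|[|[|[|[|[|[|[|r]]]]]]]]]; cbn [Nat.eqb];
    rewrite ?Nat.eqb_eq, ?andb_true_iff; try tauto.
  - destruct (chi A x) eqn:E; rewrite Nat.eqb_eq;
      [apply chi_true in E | apply chi_false in E]; tauto.
  - rewrite bex_true. split.
    + intros (z & _ & H). rewrite andb_true_iff in H. eauto.
    + intros (z & H1 & H2). exists z. rewrite andb_true_iff.
      split; [|auto]. now apply triple_bounds in H1.
  - destruct (pl x) as [|n]; cbn [Nat.eqb Nat.pred]; [tauto|].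
    rewrite bex_true. split.
    + intros (z & _ & H). rewrite andb_true_iff in H. eauto.
    + intros (z & H1 & H2). exists z. rewrite andb_true_iff.
      split; [|auto]. now apply triple_bounds in H1.
  - rewrite ball_true.
    assert (HB : forall m, bex (fun z => mem (triple (e / 10) (npair m x) (S z)) w) w = true
      <-> exists z, mem (triple (e / 10) (npair m x) (S z)) w = true).
    { intros m. rewrite bex_true. split; [intros (z & _ & H); eauto|].
      intros (z & H). exists z. split; auto. apply triple_bounds in H. lia. }
    setoid_rewrite HB. tauto.
Qed.

Lemma triple_surj (t : nat) : exists e x y, t = triple e x y.
Proof.
  exists (pl t), (pl (pr t)), (pr (pr t)). unfold triple. now rewrite !npair_unpair.
Qed.

(** The head is justified by entries of the tail, which has a smaller code and consists of true
    computations by induction. *)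
Lemma cert_sound (A : set) (w e x y : nat) :
  valid (chi A) w = true -> mem (triple e x y) w = true -> eval A e x y.
Proof.
  revert e x y. induction w as [w IH] using lt_wf_ind. intros e x y Hv Hm.
  apply mem_nonempty in Hm as (Hw & Hm). apply valid_nonempty in Hv as [Hj Hv]; auto.
  assert (Ht : tl w < w) by (assert (H := tl_le w); lia).
  destruct Hm as [Hm|Hm]; [|eauto]. rewrite Hm, justified_iff in Hj.
  apply eval_intro. revert Hj. apply eval_step_mono. eauto.
Qed.

Definition cons_cert (t w : nat) : nat := S (npair t w).

Lemma hd_cons (t w : nat) : hd (cons_cert t w) = t.
Proof. apply pl_npair. Qed.

Lemma tl_cons (t w : nat) : tl (cons_cert t w) = w.
Proof. apply pr_npair. Qed.

Lemma mem_cons (t u w : nat) :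
  mem t (cons_cert u w) = true <-> u = t \/ mem t w = true.
Proof.
  rewrite mem_nonempty, hd_cons, tl_cons. split; [tauto|]. split; [apply Nat.lt_0_succ|auto].
Qed.

Lemma valid_cons (O : nat -> bool) (t w : nat) :
  valid O (cons_cert t w) = true <-> justified O t w = true /\ valid O w = true.
Proof. rewrite valid_nonempty, hd_cons, tl_cons; [tauto|apply Nat.lt_0_succ]. Qed.

(** The entries of [w1] are pushed onto [w2] one at a time, starting from the innermost;
    justification survives because it is monotone in the list. *)
Lemma cert_merge (A : set) (w1 w2 : nat) :
  valid (chi A) w1 = true -> valid (chi A) w2 = true ->
  exists w, valid (chi A) w = true /\
    (forall t, mem t w1 = true \/ mem t w2 = true -> mem t w = true).
Proof.
  intros H1 H2. induction w1 as [w1 IH] using lt_wf_ind.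
  destruct (Nat.eq_dec w1 0) as [->|Hw].
  - exists w2. split; auto. intros t [H|H]; auto. apply mem_lt in H. lia.
  - apply valid_nonempty in H1 as [Hj H1]; [|lia].
    destruct (IH (tl w1)) as (w & Hv & Hm); auto.
    { assert (H := tl_le w1). lia. }
    exists (cons_cert (hd w1) w). rewrite valid_cons. repeat split; auto.
    + destruct (triple_surj (hd w1)) as (e & x & y & E). rewrite E in *.
      rewrite justified_iff in *. revert Hj. apply eval_step_mono. auto.
    + intros t. rewrite mem_cons, (mem_nonempty t w1). intros [(_ & [H|H])|H]; auto.
Qed.

Lemma cert_complete (A : set) (e x y : nat) :
  eval A e x y -> exists w, valid (chi A) w = true /\ mem (triple e x y) w = true.
Proof.
  revert e x y. apply eval_least. intros e x y H.
  cut (exists w, valid (chi A) w = true /\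
    eval_step A (fun e x y => mem (triple e x y) w = true) e x y).
  { intros (w & Hv & Hs). exists (cons_cert (triple e x y) w).
    rewrite valid_cons, mem_cons, justified_iff. auto. }
  unfold eval_step in *.
  destruct (e mod 10) as [|[|[|[|[|[|[|[|[|r]]]]]]]]];
    try (exists 0; split; [reflexivity|assumption]).
  - destruct H as (z & (w1 & Hv1 & H1) & (w2 & Hv2 & H2)).
    destruct (cert_merge A w1 w2) as (w & Hv & Hm); auto.
    exists w. split; [exact Hv|]. exists z. auto.
  - destruct H as ((w1 & Hv1 & H1) & (w2 & Hv2 & H2)).
    destruct (cert_merge A w1 w2) as (w & Hv & Hm); auto.
    exists w. split; [exact Hv|]. auto.
  - destruct (pl x) as [|n].
    + assumption.
    + destruct H as (z & (w1 & Hv1 & H1) & (w2 & Hv2 & H2)).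
      destruct (cert_merge A w1 w2) as (w & Hv & Hm); auto.
      exists w. split; [exact Hv|]. exists z. auto.
  - destruct H as ((w1 & Hv1 & H1) & H2).
    (* A minimisation has [y + 1] premises, each with its own certificate; they are merged one by
       one. *)
    assert (Hy : forall n, n <= y -> exists w, valid (chi A) w = true /\
      mem (triple (e / 10) (npair y x) 0) w = true /\
      forall m, m < n -> exists z, mem (triple (e / 10) (npair m x) (S z)) w = true).
    { induction n as [|n IH]; intros Hn.
      - exists w1. repeat split; auto. intros; lia.
      - destruct IH as (w2 & Hv2 & H3 & H4); [lia|].
        destruct (H2 n) as (z & w3 & Hv3 & H5); [lia|].
        destruct (cert_merge A w2 w3) as (w & Hv & Hm); auto. exists w. repeat split; auto.
        intros m Hmn. destruct (Nat.eq_dec m n) as [->|Hne].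
        + exists z. apply Hm. now right.
        + destruct (H4 m) as [u Hu]; [lia|]. exists u. apply Hm. now left. }
    destruct (Hy y) as (w & Hv & Hw); [lia|]. exists w. split; assumption.
Qed.

(** The certified computation is required to sit at the head, where [output] can read its value. *)
Definition cert (O : nat -> bool) (e x w : nat) : bool :=
  valid O w && ((0 <? w) && ((pl (hd w) =? e) && (pl (pr (hd w)) =? x))).

Definition output (w : nat) : nat := pr (pr (hd w)).

Lemma cert_eval (A : set) (e x w : nat) :
  cert (chi A) e x w = true -> eval A e x (output w).
Proof.
  unfold cert. rewrite !andb_true_iff, !Nat.eqb_eq, Nat.ltb_lt.
  intros (Hv & Hw & <- & <-). apply (cert_sound A w); auto.
  apply mem_nonempty. split; auto. left. unfold triple, output. now rewrite !npair_unpair.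
Qed.

Lemma eval_cert (A : set) (e x y : nat) :
  eval A e x y -> exists w, cert (chi A) e x w = true.
Proof.
  intros H. apply cert_complete in H as (w & Hv & Hm).
  induction w as [w IH] using lt_wf_ind.
  apply mem_nonempty in Hm as (Hw & [Hm|Hm]).
  - exists w. unfold cert. rewrite !andb_true_iff, !Nat.eqb_eq, Nat.ltb_lt, Hm.
    unfold triple. rewrite pr_npair, !pl_npair. auto.
  - apply valid_nonempty in Hv as [_ Hv]; auto. apply (IH (tl w)); auto.
    assert (H := tl_le w). lia.
Qed.

Lemma justified_local (O O' : nat -> bool) (t w : nat) :
  (forall k, k <= t -> O k = O' k) -> justified O t w = justified O' t w.
Proof.
  intros H. unfold justified. rewrite (H (pl (pr t))); [reflexivity|].
  assert (H1 := pl_le (pr t)). assert (H2 := pr_le t). lia.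
Qed.

(** The use principle: an entry queries the oracle only at its own input, which is bounded by the
    code of the list. *)
Lemma valid_local (O O' : nat -> bool) (w : nat) :
  (forall k, k <= w -> O k = O' k) -> valid O w = valid O' w.
Proof.
  intros H. unfold valid, ball. f_equal. unfold bex. f_equal. apply bmin_ext. intros i Hi.
  do 2 f_equal. apply justified_local. intros k Hk. apply H.
  assert (H1 := suffix_le w i). assert (H2 := pl_le (pred (suffix w i))). unfold hd in Hk. lia.
Qed.

Section CertRec.

Variables (AA : set -> Prop) (O : nat -> nat -> bool).
Hypothesis HO : recb AA (fun p => O (pr p) (pl p)).

Lemma recb_mem (t w : nat -> nat) :
  rec AA t -> rec AA w -> recb AA (fun c => mem (t c) (w c)).
Proof. intros. unfold mem, suffix, hd, tl. rec_auto. Qed.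

Lemma recb_justified (s t w : nat -> nat) :
  rec AA s -> rec AA t -> rec AA w -> recb AA (fun c => justified (O (s c)) (t c) (w c)).
Proof.
  intros. unfold justified, triple. cbv zeta.
  repeat first [assumption | rec_step | match goal with
  | |- recb _ (fun c => mem (@?f c) (@?g c)) => apply (recb_mem f g)
  end; cbv beta].
Qed.

(** The oracle varies with a parameter [s], to cover the stages of an approximation to a jump; a
    fixed oracle is a constant family. *)
Lemma recb_cert (s e x w : nat -> nat) :
  rec AA s -> rec AA e -> rec AA x -> rec AA w ->
  recb AA (fun c => cert (O (s c)) (e c) (x c) (w c)).
Proof.
  intros. unfold cert, valid. rec_auto.
  all: repeat match goal with
  | |- recb _ (fun c => justified (O (@?f c)) (@?g c) (@?h c)) =>
      apply (recb_justified f g h)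
  end; unfold suffix, hd, tl; rec_auto.
Qed.

End CertRec.

(** * The limit lemma *)

Lemma eventually_bounded (P : nat -> nat -> Prop) (n : nat) :
  (forall k, k < n -> exists s0, forall s, s0 <= s -> P k s) ->
  exists s0, forall s, s0 <= s -> forall k, k < n -> P k s.
Proof.
  induction n as [|n IH]; intros H.
  - exists 0. intros; lia.
  - destruct IH as [s1 H1]; [auto|]. destruct (H n) as [s2 H2]; [lia|].
    exists (s1 + s2). intros s Hs k Hk. destruct (Nat.eq_dec k n) as [->|Hne].
    + apply H2. lia.
    + apply H1; lia.
Qed.

Definition jump_approx (A : set) (s k : nat) : bool := bex (cert (chi A) k k) s.

Lemma jump_approx_limit (A : set) (k : nat) :
  exists s0, forall s, s0 <= s -> jump_approx A s k = chi (jump A) k.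
Proof.
  destruct (chi (jump A) k) eqn:E.
  - apply chi_true in E as [y Hy]. apply eval_cert in Hy as [w Hw].
    exists (S w). intros s Hs. apply bex_true. exists w. auto.
  - exists 0. intros s _. apply not_true_iff_false. intros H.
    apply bex_true in H as (w & _ & Hw). apply cert_eval in Hw.
    apply chi_false in E. apply E. now exists (output w).
Qed.

(** Stage [s] takes the least certificate below [s] that is correct for the stage [s] approximation
    of the jump. By the use principle, the true least certificate and all smaller candidates depend
    on finitely many oracle answers, which settle. *)
Theorem limit_lemma (AA : set -> Prop) (A : set) (F : nat -> nat) :
  recb AA (chi A) -> rec (eq (jump A)) F ->
  exists f, rec AA f /\ forall n, exists s0, forall s, s0 <= s -> f (npair n s) = F n.
Proof.
  intros HA [e He].
  exists (fun p => output (bmin (cert (jump_approx A (pr p)) e (pl p)) (pr p))). split.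
  - assert (HJ : recb AA (fun p => jump_approx A (pr p) (pl p))).
    { unfold jump_approx.
      apply (recb_bex AA (fun p w => cert (chi A) (pl p) (pl p) w) pr).
      - apply (recb_cert AA (fun _ => chi A)) with (s := pr); rec_auto.
      - rec_auto. }
    unfold output, hd. rec_auto.
    apply (recb_cert AA (jump_approx A)); rec_auto.
  - intros n. assert (Hn := He (jump A) eq_refl n). apply eval_cert in Hn as [w0 Hw0].
    destruct (least_witness (fun w => cert (chi (jump A)) e n w = true) w0 Hw0)
      as (w & Hw & Hl).
    destruct (eventually_bounded (fun k s => jump_approx A s k = chi (jump A) k) (S w))
      as [s0 Hs]; [intros; apply jump_approx_limit|].
    exists (s0 + w). intros s Hsw. rewrite pl_npair, pr_npair.
    assert (Hc : forall v, v <= w ->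
      cert (jump_approx A s) e n v = cert (chi (jump A)) e n v).
    { intros v Hv. unfold cert. f_equal. apply valid_local. intros k Hk. apply Hs; lia. }
    rewrite (bmin_unique _ s w).
    + apply cert_eval in Hw. eapply eval_fun; [exact Hw|]. now apply He.
    + lia.
    + intros _. now rewrite Hc.
    + intros j Hj. rewrite Hc by lia. apply not_true_iff_false, Hl, Hj.
Qed.

(** * Turing reducibility *)

Lemma recb_ext (AA : set -> Prop) (f g : nat -> bool) :
  (forall n, f n = g n) -> recb AA f -> recb AA g.
Proof. intros H. apply rec_ext. intros n. now rewrite H. Qed.

Lemma recb_oracle (A : set) : recb (eq A) (chi A).
Proof.
  exists 5. intros B <- n. destruct (chi A n) eqn:E.
  - apply (ev_orc_in A 0). now apply chi_true.
  - apply (ev_orc_out A 0). now apply chi_false.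
Qed.

Lemma recb_empty (AA : set -> Prop) : recb AA (chi empty_set).
Proof.
  apply recb_ext with (fun _ => false); [|apply recb_const].
  intros n. symmetry. apply chi_false. intros [].
Qed.

(** No program is rewritten: the new one searches for a certificate of the computation from [A],
    which is decidable as soon as [A] is, and outputs its value. *)
Lemma rec_oracle_subst (AA : set -> Prop) (A : set) (F : nat -> nat) :
  recb AA (chi A) -> rec (eq A) F -> rec AA F.
Proof.
  intros HA [e He].
  assert (Hd : rec AA (fun p => Nat.b2n (negb (cert (chi A) e (pr p) (pl p))))).
  { rec_auto. apply (recb_cert AA (fun _ => chi A)) with (s := pr); rec_auto. }
  assert (Ho : rec AA output) by (unfold output, hd; rec_auto).
  destruct Hd as [d Hd], Ho as [o Ho]. exists (c_comp o (c_min d)). intros B HB x.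
  destruct (eval_cert A e x (F x)) as [w Hw]; [now apply He|].
  destruct (eval_min_total B d x w
    (fun w => Nat.b2n (negb (cert (chi A) e x w)))) as [y Hy].
  - intros m. specialize (Hd B HB (npair m x)). cbv beta in Hd.
    now rewrite pl_npair, pr_npair in Hd.
  - now rewrite Hw.
  - econstructor; [exact Hy|]. apply eval_min_inv in Hy.
    assert (H := eval_fun B _ _ _ _ (Hd B HB (npair y x)) Hy). cbv beta in H.
    rewrite pl_npair, pr_npair in H.
    destruct (cert (chi A) e x y) eqn:E; [|discriminate]. apply cert_eval in E.
    rewrite (eval_fun A _ _ _ _ (He A eq_refl x) E). now apply Ho.
Qed.

Lemma Turing_le_trans (X Y Z : set) : Turing_le X Y -> Turing_le Y Z -> Turing_le X Z.
Proof.
  rewrite !Turing_le_rec. intros HX HY. now apply rec_oracle_subst with Y.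
Qed.

Lemma computable_Turing_le (X Y : set) : computable X -> Turing_le X Y.
Proof.
  unfold computable. rewrite !Turing_le_rec.
  apply rec_oracle_subst, recb_empty.
Qed.

Lemma rec_div2 (AA : set -> Prop) (f : nat -> nat) :
  rec AA f -> rec AA (fun n => Nat.div2 (f n)).
Proof.
  intros Hf. apply rec_ext with (fun c => bmin (fun q => f c <? 2 * S q) (f c)).
  - intros c. rewrite Nat.div2_div. apply bmin_unique.
    + apply Nat.Div0.div_le_upper_bound; lia.
    + intros _. apply Nat.ltb_lt. apply Nat.mul_succ_div_gt. lia.
    + intros j Hj. apply Nat.ltb_ge.
      assert (H := Nat.Div0.mul_div_le (f c) 2). nia.
  - rec_auto.
Qed.

Lemma join_Turing_le (X Y Z : set) :
  Turing_le X Z -> Turing_le Y Z -> Turing_le (join X Y) Z.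
Proof.
  rewrite !Turing_le_rec. intros HX HY.
  apply recb_ext with (fun n =>
    if n =? 2 * Nat.div2 n then chi X (Nat.div2 n) else chi Y (Nat.div2 n)).
  - intros n. assert (Hn := Nat.div2_odd n). rewrite <- Nat.negb_even in Hn.
    apply eq_true_iff_eq. rewrite chi_true. unfold join.
    destruct (Nat.even n); cbn [negb Nat.b2n] in Hn.
    + replace (n =? 2 * Nat.div2 n) with true; [now rewrite chi_true|].
      symmetry. apply Nat.eqb_eq. lia.
    + replace (n =? 2 * Nat.div2 n) with false; [now rewrite chi_true|].
      symmetry. apply Nat.eqb_neq. lia.
  - assert (Hd := rec_div2 (eq Z) _ (rec_id (eq Z))). rec_auto.
Qed.

(** * The recursion theorem and the requirements *)

(** Runs [u] on its own code paired with the input, as in Kleene's fixed point argument. *)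
Definition c_diag (u : nat) : nat := c_comp u (c_pair (c_const u) 2).

Lemma recursion_theorem (F : nat -> nat) :
  rec every F -> exists b, forall A x, eval A b x (F (npair b x)).
Proof.
  intros HF.
  assert (H : rec every (fun p => F (npair (c_diag (pl p)) (pr p)))) by (unfold c_diag; rec_auto).
  destruct H as [u Hu]. exists (c_diag u). intros A x.
  econstructor.
  - constructor; [apply eval_const | apply eval_id].
  - specialize (Hu A I (npair u x)). cbv beta in Hu. now rewrite pl_npair, pr_npair in Hu.
Qed.

(** With oracle X', the program [Q p] searches for [w] at which [p] diverges. The program
    [c_comp p (c_const w)] ignores its input, so it halts on its own code exactly when [p] converges
    at [w]. *)
Lemma non_total_many_one_jump_jump :
  exists Q, rec every Q /\ forall X p,
    jump (jump X) (Q p) <-> exists w, ~ exists y, eval X p w y.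
Proof.
  assert (HM : rec every (fun z => c_comp (pl z) (c_const (pr z)))) by rec_auto.
  destruct HM as [M HM].
  exists (fun p => c_min (c_comp 5 (c_comp M (c_pair (c_const p) 3)))).
  split; [rec_auto|]. intros X p.
  assert (HJ : forall w, jump X (c_comp p (c_const w)) <-> exists y, eval X p w y).
  { intros w. split.
    - intros [y Hy]. apply eval_comp_inv in Hy as (z & Hz & Hy). exists y.
      now rewrite (eval_fun _ _ _ _ _ (eval_const X w _) Hz).
    - intros [y Hy]. exists y. econstructor; [apply eval_const | exact Hy]. }
  assert (HB : forall w x, eval (jump X) (c_comp 5 (c_comp M (c_pair (c_const p) 3)))
      (npair w x) (Nat.b2n (chi (jump X) (c_comp p (c_const w))))).
  { intros w x. econstructor; [econstructor; [constructor; [apply eval_const | apply eval_left]|]|].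
    - apply HM. exact I.
    - rewrite !pl_npair, pr_npair. destruct (chi (jump X) _) eqn:E.
      + apply (ev_orc_in _ 0). now apply chi_true.
      + apply (ev_orc_out _ 0). now apply chi_false. }
  split.
  - intros [w Hw]. apply eval_min_inv in Hw. exists w. rewrite <- HJ.
    apply chi_false. assert (H := eval_fun _ _ _ _ _ (HB w _) Hw).
    now destruct (chi (jump X) (c_comp p (c_const w))).
  - intros [w Hw]. apply (eval_min_total _ _ _ w) with
      (F := fun w => Nat.b2n (chi (jump X) (c_comp p (c_const w)))); [auto|].
    rewrite <- HJ in Hw. apply chi_false in Hw. now rewrite Hw.
Qed.

(* [h <b,<e,v>>] lies outside X'' when program e decides from X an infinite set on whose
   pairs the function computed by b omits the value v; the second clause is the part of
   the converse that makes such a set contradict a limit behaviour of b. *)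
Lemma omission_index :
  exists h, rec every h /\ forall X G b e v,
    (forall x y, eval X b (npair x y) (G x y)) ->
    (forall A, (forall n, eval X e n (Nat.b2n (chi A n))) -> infinite A ->
      (forall x y, A x -> A y -> x < y -> G x y <> v) ->
      ~ jump (jump X) (h (npair b (npair e v)))) /\
    (~ jump (jump X) (h (npair b (npair e v))) ->
      forall x y, exists n, eval X e (y + n) 1 /\
        ~ (eval X e x 1 /\ eval X e y 1 /\ x < y /\ G x y = v)).
Proof.
  destruct non_total_many_one_jump_jump as (Q & HQ & HQJ).
  (* Here [a1], [a2], [a3] stand for the answers of [e] at [y + n], [x], [y]. The value 0 ends the
     search over [n]: some number at least [y] is accepted, and [x], [y] is no accepted pair of
     colour [v]. Totality of this search in [x] and [y] thus combines infinitude and omission. *)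
  set (K := fun x y a1 a2 a3 g v : nat =>
    Nat.b2n (negb ((a1 =? 1) && negb ((a2 =? 1) && ((a3 =? 1) && ((x <? y) && (g =? v))))))).
  assert (HK : rec every (fun z =>
    let w := pr (pl z) in let r := pr z in
    K (pl w) (pr w) (pl r) (pl (pr r)) (pl (pr (pr r)))
      (pl (pr (pr (pr r)))) (pr (pr (pr (pr r)))))).
  { unfold K. cbv zeta. rec_auto. }
  destruct HK as [k Hk].
  assert (Hs : rec every (fun q => pr (pr q) + pl q)) by rec_auto.
  destruct Hs as [s Hs].
  set (R := fun b e v => c_comp k (c_pair 2 (c_pair (c_comp e s)
    (c_pair (c_comp e (c_comp 3 4)) (c_pair (c_comp e (c_comp 4 4))
      (c_pair (c_comp b 4) (c_const v))))))).
  exists (fun p => Q (c_min (R (pl p) (pl (pr p)) (pr (pr p))))). split.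
  { unfold R. rec_auto. }
  intros X G b e v HG. cbv beta. rewrite !pr_npair, !pl_npair.
  assert (HR : forall n x y a1 a2 a3, eval X e (y + n) a1 -> eval X e x a2 -> eval X e y a3 ->
    eval X (R b e v) (npair n (npair x y)) (K x y a1 a2 a3 (G x y) v)).
  { intros n x y a1 a2 a3 H1 H2 H3. unfold R.
    assert (Hs' := Hs X I (npair n (npair x y))). cbv beta in Hs'.
    rewrite !pr_npair, pl_npair in Hs'.
    assert (Hr : eval X 4 (npair n (npair x y)) (npair x y)) by apply (ev_right X 0).
    assert (Hl2 : eval X 3 (npair x y) x) by apply (ev_left X 0).
    assert (Hr2 : eval X 4 (npair x y) y) by apply (ev_right X 0).
    assert (Hz : eval X (c_pair 2 (c_pair (c_comp e s)
      (c_pair (c_comp e (c_comp 3 4)) (c_pair (c_comp e (c_comp 4 4))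
      (c_pair (c_comp b 4) (c_const v)))))) (npair n (npair x y))
      (npair (npair n (npair x y)) (npair a1 (npair a2 (npair a3 (npair (G x y) v)))))).
    { constructor; [apply eval_id|]. constructor; [econstructor; eauto|].
      constructor; [econstructor; [econstructor|]; eauto|].
      constructor; [econstructor; [econstructor|]; eauto|].
      constructor; [econstructor; eauto | apply eval_const]. }
    econstructor; [exact Hz|]. assert (H := Hk X I
      (npair (npair n (npair x y)) (npair a1 (npair a2 (npair a3 (npair (G x y) v)))))).
    cbv zeta beta in H. repeat rewrite ?pr_npair, ?pl_npair in H. exact H. }
  split.
  - intros A HA Hinf Hom HJ. apply HQJ in HJ as [w Hw]. apply Hw.
    rewrite <- (npair_unpair w). set (x := pl w); set (y := pr w).
    destruct (Hinf y) as (m & Hm & Am).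
    apply (eval_min_total _ _ _ (m - y)) with (F := fun n =>
      K x y (Nat.b2n (chi A (y + n))) (Nat.b2n (chi A x)) (Nat.b2n (chi A y)) (G x y) v).
    + intros n. now apply HR.
    + replace (y + (m - y)) with m by lia.
      apply chi_true in Am. rewrite Am. unfold K.
      destruct (chi A x) eqn:Ex, (chi A y) eqn:Ey; try reflexivity.
      apply chi_true in Ex, Ey. destruct (x <? y) eqn:Exy; [|reflexivity].
      apply Nat.ltb_lt in Exy. destruct (G x y =? v) eqn:Ev; [|reflexivity].
      apply Nat.eqb_eq in Ev. now apply Hom in Ev.
  - intros Hh x y.
    assert (Hy : exists n, eval X (c_min (R b e v)) (npair x y) n).
    { apply NNPP. intros H. apply Hh, HQJ. now exists (npair x y). }
    destruct Hy as [n Hn]. apply eval_min_inv in Hn. exists n.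
    assert (Hn' := Hn). unfold R in Hn'.
    (* Convergence of the search forces [e] to converge at the three queried numbers, although [e]
       is not assumed total; determinism then identifies the other arguments of [K]. *)
    apply eval_comp_inv in Hn' as (z & Hz & _).
    apply eval_pair_inv in Hz as [_ Hz].
    apply eval_pair_inv in Hz as [H1 Hz].
    apply eval_pair_inv in Hz as [H2 Hz].
    apply eval_pair_inv in Hz as [H3 _].
    apply eval_comp_inv in H1 as (z1 & Hz1 & H1).
    apply eval_comp_inv in H2 as (z2 & Hz2 & H2).
    apply eval_comp_inv in H3 as (z3 & Hz3 & H3).
    apply eval_comp_inv in Hz2 as (z4 & Hz4 & Hz2).
    apply eval_comp_inv in Hz3 as (z5 & Hz5 & Hz3).
    apply (eval_fun _ _ _ _ _ (Hs X I _)) in Hz1. rewrite !pr_npair, pl_npair in Hz1. subst z1.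
    apply (eval_fun _ _ _ _ _ (eval_right X _)) in Hz4. rewrite pr_npair in Hz4. subst z4.
    apply (eval_fun _ _ _ _ _ (eval_right X _)) in Hz5. rewrite pr_npair in Hz5. subst z5.
    apply (eval_fun _ _ _ _ _ (eval_left X _)) in Hz2. rewrite pl_npair in Hz2. subst z2.
    apply (eval_fun _ _ _ _ _ (eval_right X _)) in Hz3. rewrite pr_npair in Hz3. subst z3.
    apply (eval_fun _ _ _ _ _ (HR n x y _ _ _ H1 H2 H3)) in Hn.
    unfold K in Hn.
    destruct (pl (pr z) =? 1) eqn:E1; [|discriminate]. apply Nat.eqb_eq in E1.
    rewrite E1 in H1. split; [exact H1|]. intros (F2 & F3 & Hxy & Hv).
    rewrite (eval_fun _ _ _ _ _ H2 F2), (eval_fun _ _ _ _ _ H3 F3) in Hn.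
    apply Nat.ltb_lt in Hxy. rewrite Hxy, Hv, !Nat.eqb_refl in Hn. discriminate.
Qed.

(** * The priority construction *)

Definition eventually_val (f : nat -> nat) (v : nat) : Prop :=
  exists s0, forall s, s0 <= s -> f s = v.

Definition stable (D : nat -> nat -> nat) : Prop :=
  forall x, exists v, eventually_val (D x) v.

Definition limit_cofinitely (D : nat -> nat -> nat) (v : nat) : Prop :=
  exists x0, forall x, x0 <= x -> eventually_val (D x) v.

Lemma low2_double_limit (X : set) :
  low2 X -> exists f c, rec every c /\
    (forall n, eventually_val (fun x => f (npair n x)) (Nat.b2n (chi (jump (jump X)) n))) /\
    (forall m, eventually_val (fun s => c (npair m s)) (f m)).
Proof.
  intros HX. apply Turing_le_rec in HX.
  destruct (limit_lemma _ _ _ (recb_oracle _) HX) as (f & Hf & Lf).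
  destruct (limit_lemma every _ _ (recb_empty _) Hf) as (c & Hc & Lc).
  now exists f, c.
Qed.

(** [Gam] turns the guesses into the colouring to be diagonalised and [col] normalises the colours.
    Computability of [Gam] is asked uniformly in an index, so that the recursion theorem applies to
    [Gam (D b)]; the last hypothesis says that [Gam] passes on a colour that wins cofinitely. *)
Lemma priority_construction (X : set) (col : nat -> nat)
    (Gam : (nat -> nat -> nat) -> nat -> nat -> nat) :
  low2 X -> rec every col ->
  (forall D : nat -> nat -> nat -> nat,
    rec every (fun p => D (pl p) (pl (pr p)) (pr (pr p))) ->
    rec every (fun p => Gam (D (pl p)) (pl (pr p)) (pr (pr p)))) ->
  (forall D v, stable D -> limit_cofinitely D (col v) -> limit_cofinitely (Gam D) (col v)) ->
  exists D, stable D /\ rec every (fun p => Gam D (pl p) (pr p)) /\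
    forall v A, Turing_le A X -> infinite A ->
      exists x y, A x /\ A y /\ x < y /\ Gam D x y = col v.
Proof.
  intros HX Hcol Hrec Hlim.
  destruct (low2_double_limit X HX) as (f & c & Hc & Lf & Lc).
  destruct omission_index as (h & Hh & Hspec).
  set (q := fun b i => h (npair b (npair (pl i) (col (pr i))))).
  (* A guess 0 puts [q b i] outside X'', so requirement [i] is believed to hold. If none below [x]
     is believed, [bmin] returns [x] and an arbitrary colour results, which does not disturb
     stability. *)
  set (D := fun b x s => col (pr (bmin (fun i => c (npair (npair (q b i) x) s) =? 0) x))).
  assert (HD : rec every (fun p => D (pl p) (pl (pr p)) (pr (pr p)))).
  { unfold D, q. rec_auto. }
  destruct (recursion_theorem _ (Hrec D HD)) as [b Hb].
  assert (HG : forall x y, eval X b (npair x y) (Gam (D b) x y)).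
  { intros x y. specialize (Hb X (npair x y)). cbv beta in Hb.
    now rewrite !pr_npair, !pl_npair, ?pr_npair in Hb. }
  assert (Lim : forall x, eventually_val (D b x)
    (col (pr (bmin (fun i => f (npair (q b i) x) =? 0) x)))).
  { intros x. destruct (eventually_bounded
      (fun i s => c (npair (npair (q b i) x) s) = f (npair (q b i) x)) x) as [s0 Hs0].
    { intros i _. apply Lc. }
    exists s0. intros s Hs. unfold D. do 2 f_equal. apply bmin_ext.
    intros i Hi. now rewrite Hs0. }
  assert (HS : stable (D b)) by (intros x; eauto).
  assert (HE : forall i, jump (jump X) (q b i)).
  { induction i as [i IH] using lt_wf_ind. apply NNPP. intros Hi.
    destruct (Hspec X _ b (pl i) (col (pr i)) HG) as [_ H2]. specialize (H2 Hi).
    destruct (eventually_bounded (fun j x =>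
      f (npair (q b j) x) = Nat.b2n (chi (jump (jump X)) (q b j))) (S i)) as [x0 Hx0].
    { intros j _. apply Lf. }
    destruct (Hlim (D b) (pr i) HS) as [x1 Hx1].
    { exists (x0 + S i). intros x Hx. specialize (Lim x).
      rewrite (bmin_unique _ x i) in Lim; [exact Lim|lia| |].
      - intros _. rewrite Hx0 by lia. apply chi_false in Hi. now rewrite Hi.
      - intros j Hj. rewrite Hx0 by lia. apply IH, chi_true in Hj. now rewrite Hj. }
    (* Take an accepted number [x1 + n] whose row has the colour as its limit, then an accepted
       number past the stage [s0] where this row has settled; the pair has the supposedly omitted
       colour. The first argument 0 is a dummy. *)
    destruct (H2 0 x1) as (n & Hn & _). destruct (Hx1 (x1 + n)) as [s0 Hs0]; [lia|].
    destruct (H2 0 (s0 + S (x1 + n))) as (m & Hm & _).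
    destruct (H2 (x1 + n) (s0 + S (x1 + n) + m)) as (_ & _ & Hc').
    apply Hc'. repeat split; auto; [lia|]. apply Hs0. lia. }
  exists (D b). split; [exact HS|]. split.
  - exists b. intros A _ p. specialize (Hb A p). cbv beta in Hb.
    now rewrite !pr_npair, !pl_npair in Hb.
  - intros v A HA Hinf. apply NNPP. intros Hno. apply Turing_le_rec in HA as [e He].
    destruct (Hspec X _ b e (col v) HG) as [H1 _].
    apply (H1 A (He X eq_refl) Hinf).
    + intros x y Ax Ay Hxy Hv. apply Hno. eauto 6.
    + specialize (HE (npair e v)). unfold q in HE. now rewrite pl_npair, pr_npair in HE.
Qed.

(** * Instances without solutions below a low2 set *)

Definition no_solution_below (Q : principle) (X : set) : Prop :=
  exists I, computable I /\ instance Q I /\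
    forall W, Turing_le W X -> ~ solution Q I W.

Lemma computable_decided (P : nat -> bool) :
  recb every P -> computable (fun n => P n = true).
Proof.
  intros [e He]. exists e. intros n. specialize (He empty_set I n). cbv beta in He.
  split; intros H; [|apply not_true_is_false in H]; now rewrite H in He.
Qed.

Lemma STS2_no_solution_below_low2 (X : set) : low2 X -> no_solution_below STS2 X.
Proof.
  intros HX.
  destruct (priority_construction X (fun v => v) (fun D => D) HX) as (D & HS & HD & Hdiag);
    [apply rec_id | auto | auto |].
  set (g := fun n => (pl (pl n) <? pr (pl n)) && (D (pl (pl n)) (pr (pl n)) =? pr n)).
  assert (Hg : forall x s v,
    graph_val (fun n => g n = true) x s v <-> x < s /\ D x s = v).
  { intros x s v. unfold graph_val, g.
    now rewrite !pl_npair, !pr_npair, andb_true_iff, Nat.ltb_lt, Nat.eqb_eq. }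
  exists (fun n => g n = true). split; [|split].
  - apply computable_decided. unfold g.
    assert (HD2 : rec every (fun n => D (pl (pl n)) (pr (pl n)))).
    { apply (rec_comp every (fun p => D (pl p) (pr p)) pl); [exact HD | rec_auto]. }
    apply recb_and; [rec_auto | apply recb_eqb; [exact HD2 | rec_auto]].
  - simpl. repeat split.
    + intros x s v H. now apply Hg in H.
    + intros x s H. exists (D x s). now apply Hg.
    + intros x s v w Hv Hw. apply Hg in Hv, Hw. intuition congruence.
    + intros n Hn. exfalso. apply (Hn (pl (pl n)) (pr (pl n)) (pr n)).
      now rewrite !npair_unpair.
    + intros x. destruct (HS x) as (v & s0 & Hs). exists v, s0.
      intros s H1 H2. apply Hg. split; [exact H2|]. apply Hs. lia.
  - intros A HA (Hinf & v & Hv).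
    destruct (Hdiag v A HA Hinf) as (x & y & Ax & Ay & Hxy & HDv).
    apply (Hv x y); auto. now apply Hg.
Qed.

(** * Lexicographic orders from colourings *)

Section Lex.

Variable D : nat -> nat -> nat.

Definition bit (k s : nat) : nat := Nat.b2n (0 <? D k s).

(* Element s sits at the node (bit 0 s, ..., bit (s-1) s) of the binary tree, and the
   order is the in-order traversal; a node is thus compared as the sequence of its
   doubled bits followed by 1s. *)
Definition key (s k : nat) : nat := if k <? s then 2 * bit k s else 1.

Definition lex (a b : nat) : Prop :=
  exists k, (forall j, j < k -> key a j = key b j) /\ key a k < key b k.

(** For [x < s] the default value [x] is meaningful: the node of [s] then extends that of [x], and
    its bit at level [x] tells the side. *)
Definition split_level (x s : nat) : nat := bmin (fun k => negb (bit k x =? bit k s)) x.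

(* For [x < s]: 1 if [x] precedes [s], 0 if [s] precedes [x]. *)
Definition above (x s : nat) : nat := bit (split_level x s) s.

Definition below (n : nat) : bool :=
  (pl n =? pr n) || (((pl n <? pr n) && (above (pl n) (pr n) =? 1)) ||
                     ((pr n <? pl n) && (above (pr n) (pl n) =? 0))).

Lemma bit_cases (k s : nat) : bit k s = 0 \/ bit k s = 1.
Proof. unfold bit. destruct (0 <? D k s); auto. Qed.

Lemma lex_trans (a b c : nat) : lex a b -> lex b c -> lex a c.
Proof.
  intros (k & Hk & Lk) (l & Hl & Ll).
  destruct (Nat.lt_trichotomy k l) as [H|[->|H]].
  - exists k. split; [|rewrite <- Hl; auto]. intros j Hj. rewrite Hk, Hl; auto; lia.
  - exists l. split; [|lia]. intros j Hj. now rewrite Hk, Hl.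
  - exists l. split; [|rewrite Hk; auto]. intros j Hj. rewrite Hk, Hl; auto; lia.
Qed.

Lemma lex_asym (a b : nat) : lex a b -> ~ lex b a.
Proof. intros H1 H2. destruct (lex_trans _ _ _ H1 H2) as (k & _ & H). lia. Qed.

(** At the splitting level [s] has key 0 or 2, whereas [x] has either the opposite of the two or the
    padding 1; the bit of [s] decides in both cases. *)
Lemma above_lex (x s : nat) : x < s ->
  (above x s = 1 -> lex x s) /\ (above x s = 0 -> lex s x).
Proof.
  intros Hxs. assert (Hle := bmin_le (fun k => negb (bit k x =? bit k s)) x).
  fold (split_level x s) in Hle.
  assert (Heq : forall j, j < split_level x s -> key x j = key s j).
  { intros j Hj. unfold key. rewrite !(proj2 (Nat.ltb_lt _ _)) by lia.
    apply bmin_min in Hj. rewrite negb_false_iff, Nat.eqb_eq in Hj. now rewrite Hj. }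
  assert (Hs : key s (split_level x s) = 2 * above x s).
  { unfold key. now rewrite (proj2 (Nat.ltb_lt _ _)) by lia. }
  assert (Hx : key x (split_level x s) = 1 \/
               key x (split_level x s) = 2 * (1 - above x s)).
  { destruct (Nat.lt_ge_cases (split_level x s) x) as [H|H].
    - right. unfold key. rewrite (proj2 (Nat.ltb_lt _ _)) by auto.
      apply bmin_sat in H. fold (split_level x s) in H.
      rewrite negb_true_iff, Nat.eqb_neq in H. unfold above.
      destruct (bit_cases (split_level x s) x), (bit_cases (split_level x s) s); lia.
    - left. unfold key. now rewrite (proj2 (Nat.ltb_ge _ _)). }
  split; intros H; exists (split_level x s); (split; [|lia]); auto.
  intros j Hj. symmetry. auto.
Qed.

Lemma below_iff (a b : nat) : below (npair a b) = true <-> a = b \/ lex a b.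
Proof.
  unfold below. rewrite pl_npair, pr_npair, !orb_true_iff, !andb_true_iff,
    !Nat.ltb_lt, !Nat.eqb_eq.
  split.
  - intros [H|[[H1 H2]|[H1 H2]]]; [auto| |]; right.
    + now apply (above_lex a b H1).
    + now apply (above_lex b a H1).
  - intros [H|H]; [auto|]. right.
    destruct (Nat.lt_trichotomy a b) as [Hab|[->|Hab]].
    + left. split; auto. destruct (bit_cases (split_level a b) b) as [E|E]; auto.
      apply above_lex in E; auto. now apply lex_asym in E.
    + now destruct (lex_asym b b H).
    + right. split; auto. destruct (bit_cases (split_level b a) a) as [E|E]; auto.
      apply above_lex in E; auto. now apply lex_asym in E.
Qed.

Lemma lex_total (a b : nat) : a = b \/ lex a b \/ lex b a.
Proof.
  destruct (Nat.lt_trichotomy a b) as [H|[H|H]]; auto.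
  - destruct (bit_cases (split_level a b) b) as [E|E]; apply above_lex in E; auto.
  - destruct (bit_cases (split_level b a) a) as [E|E]; apply above_lex in E; auto.
Qed.

Lemma bit_eventually (k v : nat) :
  eventually_val (D k) v -> eventually_val (bit k) (Nat.b2n (0 <? v)).
Proof. intros [s0 H]. exists s0. intros s Hs. unfold bit. now rewrite H. Qed.

Hypothesis HD : stable D.

(** Choice collects the limits into one path through the tree. *)
Lemma bit_limits : exists l, forall k, eventually_val (bit k) (l k).
Proof.
  exists (fun k => Nat.b2n (0 <? proj1_sig (constructive_indefinite_description _ (HD k)))).
  intros k. apply bit_eventually.
  exact (proj2_sig (constructive_indefinite_description _ (HD k))).
Qed.

(** Once the bits at levels up to and including [x] have settled, the node of [x] is compared with
    the limiting path only. *)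
Lemma above_stable : stable above.
Proof.
  destruct bit_limits as [l Hl]. intros x.
  destruct (eventually_bounded (fun k s => bit k s = l k) (S x)) as [s0 Hs]; [intros; apply Hl|].
  exists (l (bmin (fun k => negb (bit k x =? l k)) x)), s0. intros s Hss.
  assert (E : split_level x s = bmin (fun k => negb (bit k x =? l k)) x).
  { apply bmin_ext. intros k Hk. now rewrite (Hs s) by lia. }
  unfold above. rewrite E. apply Hs; auto.
  assert (H := bmin_le (fun k => negb (bit k x =? l k)) x). lia.
Qed.

(* If the colour is [v] from [x0] on, then all late elements agree with the limiting
   path up to level [x0], so they split from later elements at a level beyond [x0],
   where the limiting bit is [v]. *)
Lemma above_limit_cofinitely (v : nat) :
  limit_cofinitely D v -> limit_cofinitely above (Nat.b2n (0 <? v)).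
Proof.
  destruct bit_limits as [l Hl]. intros [x0 Hx0].
  destruct (eventually_bounded (fun k s => bit k s = l k) x0) as [s0 Hs0]; [intros; apply Hl|].
  exists (s0 + x0). intros x Hx.
  destruct (eventually_bounded (fun k s => bit k s = l k) (S x)) as [s1 Hs1]; [intros; apply Hl|].
  exists s1. intros s Hs.
  assert (Hle := bmin_le (fun k => negb (bit k x =? bit k s)) x).
  fold (split_level x s) in Hle.
  assert (Hge : x0 <= split_level x s).
  { destruct (Nat.le_gt_cases x0 (split_level x s)) as [H|H]; auto. exfalso.
    assert (Hlt : split_level x s < x) by lia.
    apply bmin_sat in Hlt. fold (split_level x s) in Hlt.
    rewrite negb_true_iff, Nat.eqb_neq in Hlt. apply Hlt.
    rewrite Hs0, Hs1; auto; lia. }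
  unfold above. rewrite Hs1 by lia.
  destruct (Hl (split_level x s)) as [t1 Ht1].
  destruct (bit_eventually _ _ (Hx0 _ Hge)) as [t2 Ht2].
  now rewrite <- (Ht1 (t1 + t2)), Ht2 by lia.
Qed.

Lemma below_SADS_instance : SADS_instance (fun n => below n = true).
Proof.
  unfold SADS_instance, lo_lt, lo_le. setoid_rewrite below_iff. repeat split.
  - intros n Hn. exfalso. apply (Hn (pl n) (pr n)). now rewrite npair_unpair.
  - auto.
  - intros a b [|H1] [|H2]; auto. now apply lex_asym in H1.
  - intros a b c [->|H1] [->|H2]; eauto using lex_trans.
  - intros a b. destruct (lex_total a b) as [|[|]]; auto.
  - intros a. destruct (above_stable a) as (v & s0 & Hs).
    (* The limit is read off at [s0]. Limit 0 puts almost all elements before [a], so its successors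
       are bounded; limit 1 bounds its predecessors. *)
    destruct (bit_cases (split_level a s0) s0) as [E|E];
      fold (above a s0) in E; rewrite Hs in E by auto; subst v.
    + right. exists (s0 + S a). intros b [[->|H] Hne]; [congruence|].
      destruct (Nat.lt_ge_cases b (s0 + S a)) as [|Hb]; auto. exfalso.
      assert (Hab : above a b = 0) by (apply Hs; lia).
      apply above_lex in Hab; [|lia]. now apply lex_asym in H.
    + left. exists (s0 + S a). intros b [[->|H] Hne]; [congruence|].
      destruct (Nat.lt_ge_cases b (s0 + S a)) as [|Hb]; auto. exfalso.
      assert (Hab : above a b = 1) by (apply Hs; lia).
      apply above_lex in Hab; [|lia]. now apply lex_asym in H.
Qed.

End Lex.

(** On its pairs an ascending sequence omits the value 0 of [above], and a descending one omits
    1. *)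
Lemma SADS_no_solution_below_low2 (X : set) : low2 X -> no_solution_below SADS X.
Proof.
  intros HX.
  destruct (priority_construction X (fun v => Nat.b2n (0 <? v)) above HX)
    as (D & HS & HD & Hdiag).
  - rec_auto.
  - intros D HD. unfold above, split_level, bit. rec_auto.
  - intros D v HS HL. apply above_limit_cofinitely in HL; auto. now destruct v.
  - exists (fun n => below D n = true). split; [|split].
    + apply computable_decided. unfold below.
      assert (HD2 : rec every (fun n => above D (pr n) (pl n))).
      { apply rec_ext with (fun n => (fun p => above D (pl p) (pr p)) (npair (pr n) (pl n))).
        - intros n. now rewrite pl_npair, pr_npair.
        - apply (rec_comp every _ _ HD). rec_auto. }
      rec_auto.
    + now apply below_SADS_instance.
    + intros A HA [Hinf [Hup|Hdown]].
      * destruct (Hdiag 0 A HA Hinf) as (x & y & Ax & Ay & Hxy & E).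
        destruct (Hup x y Ax Ay Hxy) as [H Hne]. unfold lo_le in H.
        apply below_iff in H. apply above_lex in E; auto.
        destruct H as [|H]; [lia|]. now apply lex_asym in H.
      * destruct (Hdiag 1 A HA Hinf) as (x & y & Ax & Ay & Hxy & E).
        destruct (Hdown x y Ax Ay Hxy) as [H Hne]. unfold lo_le in H.
        apply below_iff in H. apply above_lex in E; auto.
        destruct H as [|H]; [lia|]. now apply lex_asym in H.
Qed.

(** * From low2 sets to universal instances *)

(** A computable instance of [Q] reduces to a computable instance of [P]; joining a solution of the
    latter with the computable [J] does not leave the sets below [X]. *)
Lemma bounds_c_reducible (P Q : principle) (X : set) :
  bounds X P -> c_reducible Q P -> ~ no_solution_below Q X.
Proof.
  intros HB HR (J & HJ & IJ & HN).
  destruct (HR J IJ) as (K & HK & IK & Hsol).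
  destruct (HB K) as (Z & HZ & SZ); [now apply Turing_le_trans with J | auto |].
  destruct (Hsol Z SZ) as (W & HW & SW). apply (HN W); auto.
  apply Turing_le_trans with (join J Z); auto.
  apply join_Turing_le; auto. now apply computable_Turing_le.
Qed.

Theorem theorem4p2 (P : principle) :
  arithmetical_principle P ->
  (exists M : set -> Prop, omega_model P M /\ (forall X, M X -> low2 X)) ->
  (c_reducible STS2 P \/ c_reducible SADS P) ->
  ~ admits_universal_instance P.
Proof.
  intros _ (M & ((Z & MZ) & _ & Hdown & Hsol) & Hlow) HR (U & HU & IU & Huniv).
  (* A nonempty collection closed downwards contains every computable set. *)
  assert (MU : M U) by (apply (Hdown U Z MZ), computable_Turing_le, HU).
  destruct (Hsol U MU IU) as (Y & MY & SY). specialize (Huniv Y SY).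
  destruct HR as [HR|HR]; apply (bounds_c_reducible _ _ _ Huniv HR).
  - apply STS2_no_solution_below_low2; auto.
  - apply SADS_no_solution_below_low2; auto.
Qed.
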